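(* Let $\mathcal{M}$ be a von Neumann algebra with a finite normal faithful trace $\tau$ normalized by $\tau(I)=1$, let $H_0=H_0^*$ be affiliated with $\mathcal{M}$ and let $V=V^*\in\mathcal{M}$. Assume that $(zI-H_0)^{-1}$ and $V$ are free. Then, for every $p\in\mathbf{N}$, the set functions $$m_{p,H_0,V}(A_1\times\cdots\times A_p)=\tau\big[E_{H_0}(A_1)VE_{H_0}(A_2)V\cdots VE_{H_0}(A_p)V\big]$$ and $$m^{(1)}_{p,H_0,V}(A_1\times\cdots\times A_p\times A_{p+1})=\tau\big[E_{H_0}(A_1)VE_{H_0}(A_2)V\cdots VE_{H_0}(A_p)VE_{H_0}(A_{p+1})\big],$$ defined on products of Borel subsets $A_j$ of $\mathbf{R}$, extend to countably additive measures of bounded variation (on $\mathbf{R}^p$ and $\mathbf{R}^{p+1}$, respectively).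
   Context: $E_{H_0}$ is the spectral measure of $H_0$. Freeness of $(zI-H_0)^{-1}$ and $V$ means freeness (in Voiculescu's sense, with respect to $\tau$) of the algebra generated by the spectral projections of $H_0$ and the unital algebra generated by $V$. *)

(* Defs.v *)
From HB Require Import structures.
From mathcomp Require Import all_boot all_order all_algebra.
From mathcomp Require Import all_classical all_reals all_analysis.
From mathcomp Require Export complex.

Set Implicit Arguments.
Unset Strict Implicit.
Unset Printing Implicit Defensive.

Import Order.TTheory GRing.Theory Num.Theory.
Import numFieldNormedType.Exports.

Local Open Scope classical_set_scope.
Local Open Scope ring_scope.

(* The inner product is linear in its first argument, conjugate-linear in the
   second.  A complex Hilbert space is a complete normed space H together with
   an inner product which induces its norm. *)
Notation inner_product H := {dot H for Num.conj}.

Definition induces_norm (R : realType) (H : completeNormedModType R[i])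
    (dot : inner_product H) := forall x : H, `|x| ^+ 2 = dot x x.

Section Operators.
Context {R : realType} {H : completeNormedModType R[i]}.
Variable dot : inner_product H.
Implicit Types (f g u : H -> H) (M S : set (H -> H)).

Definition bounded_operator f := linear f /\ continuous f.

Definition adjoint_of f g := forall x y, dot (f x) y = dot x (g y).

Definition self_adjoint f := bounded_operator f /\ adjoint_of f f.

Definition orthogonal_projection f := self_adjoint f /\ f \o f = f.

Definition unitary u := bounded_operator u /\
  exists v, [/\ bounded_operator v, adjoint_of u v, u \o v = id & v \o u = id].

(* In the order of R[i], 0 <= z means that z is real and nonnegative, so both
   predicates below include the reality of the quadratic form. *)
Definition op_ge0 f := forall x, 0 <= dot (f x) x.

Definition op_le f g := op_ge0 (g - f).

Definition commutant S : set (H -> H) :=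
  [set f | bounded_operator f /\ forall g, S g -> f \o g = g \o f].

Definition von_neumann_algebra M :=
  [/\ M `<=` bounded_operator,
      forall f, M f -> exists2 g, M g & adjoint_of f g &
      commutant (commutant M) = M].

(* s is the supremum of D among the elements of M *)
Definition op_sup M (D : set (H -> H)) (s : H -> H) :=
  [/\ M s, forall f, D f -> op_le f s &
      forall t, M t -> (forall f, D f -> op_le f t) -> op_le s t].

Definition directed (D : set (H -> H)) :=
  D !=set0 /\
  forall f g, D f -> D g -> exists h, [/\ D h, op_le f h & op_le g h].

(* Only the values of tau on M are meaningful. *)
Record normal_faithful_trace M (tau : (H -> H) -> R[i]) : Prop := {
  trace_linear : forall (a : R[i]) f g, M f -> M g ->
    tau (a *: f + g) = a * tau f + tau g ;
  trace_ge0 : forall f, M f -> op_ge0 f -> 0 <= tau f ;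
  trace_cyclic : forall f g, M f -> M g -> tau (f \o g) = tau (g \o f) ;
  trace_faithful : forall f, M f -> op_ge0 f -> tau f = 0 -> f = 0 ;
  trace_normal : forall (D : set (H -> H)) s,
    D `<=` M -> D `<=` op_ge0 -> directed D -> op_sup M D s ->
    supremums (tau @` D) (tau s) ;
  trace_id : tau id = 1 }.

(* A possibly unbounded operator; the values of op_fun outside op_dom are
   irrelevant. *)
Record unbounded_operator := UnboundedOperator {
  op_dom : set H ;
  op_fun : H -> H }.

(* The last clause says that the graph of the adjoint of T is that of T. *)
Definition self_adjoint_unbounded (T : unbounded_operator) :=
  [/\ dense (op_dom T),
      forall (a : R[i]) x y, op_dom T x -> op_dom T y ->
        op_dom T (a *: x + y) /\
        op_fun T (a *: x + y) = a *: op_fun T x + op_fun T y &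
      forall y z, (forall x, op_dom T x -> dot (op_fun T x) y = dot x z) <->
        op_dom T y /\ op_fun T y = z].

(* u T u^* = T for every unitary u in the commutant of M *)
Definition affiliated M (T : unbounded_operator) :=
  forall u, commutant M u -> unitary u ->
    (forall x, op_dom T (u x) <-> op_dom T x) /\
    (forall x, op_dom T x -> op_fun T (u x) = u (op_fun T x)).

(* Only the values of E on Borel sets are meaningful. *)
Definition projection_valued_measure (E : set (measurableTypeR R) -> H -> H) :=
  [/\ forall A, measurable A -> orthogonal_projection (E A),
      E setT = id,
      forall A B, measurable A -> measurable B ->
        E (A `&` B) = E A \o E B &
      forall F : nat -> set (measurableTypeR R),
        (forall n, measurable (F n)) -> trivIset setT F ->
        forall x, series (fun n => E (F n) x) @ \oo --> E (\bigcup_n F n) x].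

(* T = \int l dE(l), where the measure A |-> <E(A)x, x> determines both the
   domain and the quadratic form of T. *)
Definition spectral_measure_of (T : unbounded_operator)
    (E : set (measurableTypeR R) -> H -> H) :=
  projection_valued_measure E /\
  forall x, exists mu : {measure set (measurableTypeR R) -> \bar R},
    [/\ forall A, measurable A -> mu A = (complex.Re (dot (E A x) x))%:E,
        op_dom T x <-> (\int[mu]_l (l ^+ 2)%:E < +oo)%E &
        op_dom T x -> dot (op_fun T x) x = (\int[mu]_l l)%:C%C].

End Operators.

Section Freeness.
Context {R : realType} {H : completeNormedModType R[i]}.

(* noncommutative product a_0 a_1 ... a_(n-1) *)
Definition op_prod n (a : 'I_n -> H -> H) : H -> H :=
  \big[(fun f g : H -> H => f \o g)/id]_(i < n) a i.

Definition unital_subalgebra (A : set (H -> H)) :=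
  [/\ A id,
      forall (a : R[i]) f g, A f -> A g -> A (a *: f + g) &
      forall f g, A f -> A g -> A (f \o g)].

Definition generated_algebra (S : set (H -> H)) : set (H -> H) :=
  \bigcap_(A in [set A | unital_subalgebra A /\ S `<=` A]) A.

Definition free (tau : (H -> H) -> R[i]) (I : Type) (A : I -> set (H -> H)) :=
  forall n (k : 'I_n.+1 -> I) (a : 'I_n.+1 -> H -> H),
    (forall i, A (k i) (a i)) ->
    (forall i, tau (a i) = 0) ->
    (forall i j : 'I_n.+1, j = i.+1 :> nat -> k i <> k j) ->
    tau (op_prod a) = 0.

Definition free_pair tau (A B : set (H -> H)) :=
  free tau (fun b : bool => if b then A else B).

(* tau[E(A_1) V E(A_2) V ... V E(A_p) V] *)
Definition m_ p (tau : (H -> H) -> R[i])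
    (E : set (measurableTypeR R) -> H -> H) (V : H -> H)
    (A : 'I_p -> set (measurableTypeR R)) : R[i] :=
  tau (op_prod (fun i => E (A i) \o V)).

(* tau[E(A_1) V E(A_2) V ... V E(A_p) V E(A_(p+1))] *)
Definition m1_ p (tau : (H -> H) -> R[i])
    (E : set (measurableTypeR R) -> H -> H) (V : H -> H)
    (A : 'I_p.+1 -> set (measurableTypeR R)) : R[i] :=
  tau (op_prod (fun i : 'I_p => E (A (widen_ord (leqnSn p) i)) \o V)
       \o E (A ord_max)).

End Freeness.

(* Used with K := R[i], i.e. for complex measures. *)
Section FieldValuedMeasures.
Context {K : numFieldType} {d : measure_display} {T : measurableType d}.
Implicit Type nu : set T -> K.

Definition countably_additive nu :=
  forall F : nat -> set T, (forall n, measurable (F n)) -> trivIset setT F ->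
    series (nu \o F) @ \oo --> nu (\bigcup_n F n).

Definition bounded_variation nu :=
  exists B : K, forall n (F : 'I_n -> set T),
    (forall i, measurable (F i)) -> trivIset setT F ->
    \sum_(i < n) `|nu (F i)| <= B.

End FieldValuedMeasures.

(* A_1 x ... x A_n; n.-tuple carries the product sigma-algebra, which for
   Borel factors is the Borel sigma-algebra of R^n. *)
Definition box {d} {T : measurableType d} n (A : 'I_n -> set T) :
    set (n.-tuple T) := [set x | forall i, A i (tnth x i)].

Definition extends_to_measure (R : realType) n
    (m : ('I_n -> set (measurableTypeR R)) -> R[i]) :=
  exists nu : set (n.-tuple (measurableTypeR R)) -> R[i],
    [/\ countably_additive nu, bounded_variation nu &
        forall A, (forall i, measurable (A i)) -> nu (box A) = m A].

(* Main.v *)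
Require Import Defs.
From HB Require Import structures.
From mathcomp Require Import all_boot all_order all_algebra.
From mathcomp Require Import all_classical all_reals all_analysis.
From mathcomp Require Import measurable_realfun ring lra.

Set Implicit Arguments.
Unset Strict Implicit.
Unset Printing Implicit Defensive.

Import Order.TTheory GRing.Theory Num.Theory.
Import numFieldNormedType.Exports.

Local Open Scope classical_set_scope.
Local Open Scope ring_scope.

(** The argument has two halves.

    Operator theory. The spectral projections E(A) of the affiliated operator
    must first be shown to lie in M, for tau says nothing outside M. The range
    of E[a-c,a+c] can be read off from the operator T alone: it consists of the
    x such that (T-a)^n x exists and has norm at most c^n |x| for every n
    ([band_orbit], [orbit_band]). A unitary of the commutant M' commutes with T,
    so it preserves these ranges and commutes with E of every band, hence with E
    of every Borel set ([comm_unitary]). The elements of M' are combinations of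
    self-adjoint contractions, which are recovered from their unitary Cayley
    transforms, so E(A) commutes with all of M' and lies in M'' = M ([pvm_mem]).
    Normality of the trace then makes A |-> tau(E(A)) a probability measure P on
    the line ([trace_distribution]).

    Freeness. A word E(A_1) b_1 E(A_2) b_2 ... with b_i in the algebra of V has
    as trace a linear combination, with coefficients that do not depend on the
    A_i, of products of numbers P(A_i cap A_j cap ...) in which every index
    occurs exactly once ([word_expandable]). This is the usual centering
    argument: freeness kills the alternating words in centered letters, and the
    correction terms are shorter words, in which neighbouring projections merge
    by E(A)E(B) = E(A cap B). For each way of grouping the indices into blocks,
    such a product is the value on A_1 x ... x A_p of the law of a random vector
    whose coordinates coincide within a block and are otherwise independent with
    law P ([block_measure]). A finite complex combination of probability
    measures is countably additive and of bounded variation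
    ([combination_complex_measure]), which ends the proof. *)

(** * Hilbert space: the real inner product, Riesz representation, adjoints *)

Section RealInnerProduct.
Context {R : realType} {H : completeNormedModType R[i]}.
Variable dot : inner_product H.
Hypothesis dotE : induces_norm dot.

(** Most estimates are about real numbers, so they are made with the real inner
    product Re (dot x y) and the real-valued norm; complex linearity recovers
    dot itself. *)
Definition rdot (x y : H) : R := complex.Re (dot x y).

Definition nrm (x : H) : R := complex.Re `|x|.

Lemma ReD (a b : R[i]) : complex.Re (a + b) = complex.Re a + complex.Re b.
Proof. by case: a b => [? ?] []. Qed.

Lemma ReN (a : R[i]) : complex.Re (- a) = - complex.Re a.
Proof. by case: a. Qed.

Lemma ReZ (a : R) (b : R[i]) : complex.Re (a%:C%C * b) = a * complex.Re b.
Proof. by case: b => b c /=; rewrite mul0r subr0. Qed.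

Lemma Re_conj (a : R[i]) : complex.Re (Num.conj a) = complex.Re a.
Proof. by case: a. Qed.

Lemma dotC x y : dot x y = Num.conj (dot y x).
Proof. by rewrite (hermC dot x y) /= expr0 mul1r. Qed.

Lemma dotZl a x y : dot (a *: x) y = a * dot x y.
Proof. exact: (linearZl_LR dot y a x). Qed.

Lemma dotZr a x y : dot x (a *: y) = Num.conj a * dot x y.
Proof. by rewrite dotC dotZl rmorphM [in RHS]dotC. Qed.

Lemma dotDr x y z : dot z (x + y) = dot z x + dot z y.
Proof. exact: linearDr. Qed.

Lemma rdotC x y : rdot x y = rdot y x.
Proof. by rewrite /rdot dotC Re_conj. Qed.

Lemma rdotDl x y z : rdot (x + y) z = rdot x z + rdot y z.
Proof. by rewrite /rdot linearDl ReD. Qed.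

Lemma rdotDr x y z : rdot z (x + y) = rdot z x + rdot z y.
Proof. by rewrite /rdot linearDr ReD. Qed.

Lemma rdotNl x z : rdot (- x) z = - rdot x z.
Proof. by rewrite /rdot linearNl ReN. Qed.

Lemma rdotNr x z : rdot z (- x) = - rdot z x.
Proof. by rewrite /rdot linearNr ReN. Qed.

Lemma rdotBl x y z : rdot (x - y) z = rdot x z - rdot y z.
Proof. by rewrite rdotDl rdotNl. Qed.

Lemma rdotBr x y z : rdot z (x - y) = rdot z x - rdot z y.
Proof. by rewrite rdotDr rdotNr. Qed.

Lemma rdotZl (a : R) x y : rdot (a%:C%C *: x) y = a * rdot x y.
Proof. by rewrite /rdot dotZl ReZ. Qed.

Lemma rdotZr (a : R) x y : rdot x (a%:C%C *: y) = a * rdot x y.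
Proof. by rewrite rdotC rdotZl rdotC. Qed.

Lemma rdot0r x : rdot x 0 = 0.
Proof. by rewrite /rdot linear0r. Qed.

Lemma Re_iM (z : R[i]) : complex.Re ('i%C * z) = - complex.Im z.
Proof. by rewrite mulrC ReiNIm. Qed.

Lemma rdotil x y : rdot ('i%C *: x) y = - complex.Im (dot x y).
Proof. by rewrite /rdot dotZl Re_iM. Qed.

Lemma rdotir x y : rdot x ('i%C *: y) = complex.Im (dot x y).
Proof. by rewrite rdotC rdotil dotC; case: (dot x y) => a b /=; rewrite opprK. Qed.

Lemma rdoti x y : rdot ('i%C *: x) y = - rdot x ('i%C *: y).
Proof. by rewrite rdotil rdotir. Qed.

Lemma normE (x : H) : `|x| = (nrm x)%:C%C.
Proof. by rewrite /nrm RRe_real// normr_real. Qed.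

Lemma nrm_ge0 x : 0 <= nrm x.
Proof. by rewrite -ler0c -normE. Qed.

Lemma rdotxx x : rdot x x = nrm x ^+ 2.
Proof.
by rewrite /rdot -dotE normE -rmorphXn.
Qed.

Lemma dotxx x : dot x x = (nrm x ^+ 2)%:C%C.
Proof. by rewrite -dotE normE rmorphXn. Qed.

Lemma nrm0 : nrm 0 = 0.
Proof. by rewrite /nrm normr0. Qed.

Lemma nrm_eq0 x : nrm x = 0 -> x = 0.
Proof. by move=> h; apply/eqP; rewrite -normr_eq0 normE h. Qed.

Lemma nrmD x y : nrm (x + y) <= nrm x + nrm y.
Proof. by rewrite -lecR rmorphD /= -!normE ler_normD. Qed.

Lemma nrmN x : nrm (- x) = nrm x.
Proof. by rewrite /nrm normrN. Qed.

Lemma nrmB x y : nrm (x - y) <= nrm x + nrm y.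
Proof. by rewrite (le_trans (nrmD _ _))// nrmN. Qed.

Lemma nrmZ (a : R) x : nrm (a%:C%C *: x) = `|a| * nrm x.
Proof.
rewrite /nrm normrZ normc_def /= expr0n addr0 sqrtr_sqr normE.
by rewrite -rmorphM.
Qed.

Lemma nrmi x : nrm ('i%C *: x) = nrm x.
Proof.
rewrite /nrm normrZ normc_def /= expr0n /= expr1n add0r sqrtr1.
by rewrite (_ : 1%:C%C = 1)// mul1r.
Qed.

Lemma rdot_le_nrm x y : `|rdot x y| <= nrm x * nrm y.
Proof.
have [->|y0] := eqVneq y 0; first by rewrite rdot0r normr0 nrm0 mulr0.
have ny : 0 < nrm y.
  rewrite lt0r nrm_ge0 andbT; apply: contra y0 => /eqP h.
  by apply/eqP; apply: nrm_eq0.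
pose z := x - (rdot x y / nrm y ^+ 2)%:C%C *: y.
have : 0 <= rdot z z by rewrite rdotxx sqr_ge0.
rewrite /z rdotBl !rdotBr !rdotZl !rdotZr !rdotxx (rdotC y x).
set a := rdot x y; set b := nrm y; set c := nrm x => h.
have h2 : a ^+ 2 <= (c * b) ^+ 2.
  have e : c ^+ 2 - a / b ^+ 2 * a - (a / b ^+ 2 * a - a / b ^+ 2 *
      (a / b ^+ 2 * b ^+ 2)) = ((c * b) ^+ 2 - a ^+ 2) / b ^+ 2.
    by field; rewrite lt0r_neq0.
  move: h; rewrite e pmulr_lge0 ?invr_gt0 ?exprn_gt0//.
  by rewrite subr_ge0.
rewrite -(ler_pXn2r (n := 2))// ?nnegrE ?mulr_ge0 ?nrm_ge0//.
by rewrite real_normK// num_real.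
Qed.

Lemma rdot_eq0 x : (forall y, rdot x y = 0) -> x = 0.
Proof.
move=> h; apply: nrm_eq0; have := h x; rewrite rdotxx => /eqP.
by rewrite sqrf_eq0 => /eqP.
Qed.

Lemma rdot_inj x y : (forall z, rdot x z = rdot y z) -> x = y.
Proof.
move=> h; apply/eqP; rewrite -subr_eq0; apply/eqP; apply: rdot_eq0 => z.
by rewrite rdotBl h subrr.
Qed.

Lemma dot_of_rdot x y x' y' : rdot x y = rdot x' y' ->
  rdot ('i%C *: x) y = rdot ('i%C *: x') y' -> dot x y = dot x' y'.
Proof.
rewrite !rdotil /rdot => h1 /oppr_inj h2.
by apply/eqP; rewrite eq_complex h1 h2 !eqxx.
Qed.

Lemma cvg_nrmP (x_ : nat -> H) l : x_ @ \oo --> l <->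
  (forall e : R, 0 < e -> \forall n \near \oo, nrm (l - x_ n) < e).
Proof.
rewrite -[X in X @ _](_ : (fun n => x_ n) = _)//; split.
- move=> /cvgrPdist_lt h e e0.
  have /h : (0 : R[i]) < e%:C%C by rewrite ltcR.
  by apply: filterS => n; rewrite normE ltcR.
- move=> h; apply/cvgrPdist_lt => e e0.
  have eE : e = (complex.Re e)%:C%C by rewrite RRe_real// gtr0_real.
  rewrite eE; move: e0; rewrite eE ltcR => /h.
  by apply: filterS => n; rewrite normE ltcR.
Qed.

Lemma cvg_rdot (x_ : nat -> H) l y : x_ @ \oo --> l ->
  rdot (x_ n) y @[n --> \oo] --> rdot l y.
Proof.
move=> /cvg_nrmP h; apply/cvgrPdist_lt => e e0.
have ny : 0 < nrm y + 1 by rewrite ltr_wpDl ?nrm_ge0.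
have /h := divr_gt0 e0 ny.
apply: filterS => n hn; rewrite -rdotBl.
rewrite (le_lt_trans (rdot_le_nrm _ _))//.
move: hn; rewrite ltr_pdivlMr//; apply: le_lt_trans.
by rewrite ler_wpM2l ?nrm_ge0// lerDl.
Qed.

Lemma cvg_lin (x_ : nat -> H) l (f : H -> H) : bounded_operator f ->
  x_ @ \oo --> l -> f (x_ n) @[n --> \oo] --> f l.
Proof.
by move=> [_ cf] h; apply: cvg_comp; [exact: h|exact: (cf l)].
Qed.

Lemma nrm_complete (x_ : nat -> H) :
  (forall e : R, 0 < e -> exists N, forall m n, (N <= m)%N -> (N <= n)%N ->
     nrm (x_ m - x_ n) < e) -> exists l : H, x_ @ \oo --> l.
Proof.
move=> h.
have : cauchy (x_ @ \oo).
  apply: cauchy_exP => e e0.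
  have eE : e = (complex.Re e)%:C%C by rewrite RRe_real// gtr0_real.
  move: e0; rewrite eE ltcR => /h [N hN].
  exists (x_ N); exists N => // n /= Nn.
  by rewrite -ball_normE /ball_ /= normE ltcR hN.
by move=> /cauchy_cvgP h2; exists (lim (x_ @ \oo)).
Qed.

Lemma linearP0 (f : H -> H) : linear f -> f 0 = 0.
Proof.
by move=> fl; have := fl (-1) 0 0; rewrite addr0 !scaleN1r addNr oppr0.
Qed.

Lemma linear_add (f : H -> H) x y : linear f -> f (x + y) = f x + f y.
Proof. by move=> fl; have := fl 1 x y; rewrite !scale1r. Qed.

Lemma linear_scale (f : H -> H) a x : linear f -> f (a *: x) = a *: f x.
Proof. by move=> fl; have := fl a x 0; rewrite (linearP0 fl) !addr0. Qed.

Lemma linear_opp (f : H -> H) x : linear f -> f (- x) = - f x.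
Proof. by move=> fl; rewrite -scaleN1r linear_scale// scaleN1r. Qed.

Lemma linear_sub (f : H -> H) x y : linear f -> f (x - y) = f x - f y.
Proof. by move=> fl; rewrite linear_add// linear_opp. Qed.

Lemma bounded_operatorP (f : H -> H) : bounded_operator f <->
  linear f /\ exists2 C : R, 0 <= C & forall x, nrm (f x) <= C * nrm x.
Proof.
split=> -[fl fc]; split=> //.
- pose g : {linear H -> H} := HB.pack f (GRing.isLinear.Build _ _ _ _ f fl).
  have /linear_bounded_continuous /linear_boundedP [C0 [C0r hC]] : continuous g by [].
  pose C := `|complex.Re C0| + 1.
  have C1 : C0 < C%:C%C.
    rewrite -(RRe_real C0r) ltcR /C.
    by rewrite (le_lt_trans (ler_norm _))// ltrDl.
  exists C; first by rewrite addr_ge0.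
  by move=> x; have := hC _ C1 x; rewrite !normE -rmorphM /= lecR.
- have [C C0 hC] := fc.
  pose g : {linear H -> H} := HB.pack f (GRing.isLinear.Build _ _ _ _ f fl).
  suff : continuous g by [].
  apply/linear_bounded_continuous/linear_boundedP; exists C%:C%C; split.
    by rewrite ger0_real// ler0c.
  move=> r Cr x; apply: (@le_trans _ _ (C%:C%C * `|x|)).
    by rewrite !normE -rmorphM /= lecR.
  by rewrite ler_wpM2r// ltW.
Qed.

(** Riesz representation, over the real scalars: a minimizing sequence of
    |x|^2 - 2 phi x is Cauchy by the parallelogram law, and its limit
    represents phi because the first variation vanishes there. *)
Lemma riesz (phi : H -> R) (C : R) :
  (forall x y, phi (x + y) = phi x + phi y) ->
  (forall (a : R) x, phi (a%:C%C *: x) = a * phi x) ->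
  (forall x, `|phi x| <= C * nrm x) ->
  exists z, forall x, phi x = rdot x z.
Proof.
move=> phiD phiZ phiC.
pose J (x : H) : R := nrm x ^+ 2 - 2 * phi x.
have Jlb x : - C ^+ 2 <= J x.
  have := phiC x; rewrite ler_norml => /andP[_ h].
  rewrite /J; have := sqr_ge0 (nrm x - C); rewrite sqrrB; lra.
pose S := [set J x | x in [set: H]].
have hS : has_inf S.
  split; first by exists (J 0), 0.
  by exists (- C ^+ 2) => _ [x _ <-].
pose m : R := inf S.
have Jm x : m <= J x by apply: ge_inf => //; [case: hS | exists x].
have eps n : (0 : R) < n.+1%:R^-1 by rewrite invr_gt0.
have /choice[x_ hx] : forall n : nat, exists x, J x < m + n.+1%:R^-1.
  move=> n; have [_ [x _ <-]] := inf_adherent (eps n) hS.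
  by rewrite -/m => hx; exists x.
(* the parallelogram law at the midpoint of x and y *)
have Jmid x y : nrm (x - y) ^+ 2 <= 2 * (J x - m) + 2 * (J y - m).
  pose half : R := 2^-1.
  have := Jm (half%:C%C *: (x + y)); rewrite /J.
  rewrite -!rdotxx phiZ phiD !rdotZl !rdotZr !rdotDl !rdotDr !rdotNl.
  rewrite !rdotNr (rdotC y x).
  have aux (h a b c d e p : R) : h = 2^-1 ->
      p <= h * (h * (a + c + (c + b))) - 2 * (h * (d + e)) ->
      a - c + (- c - - b) <= 2 * (a - 2 * d - p) + 2 * (b - 2 * e - p).
    by move=> ->; lra.
  exact: aux.
have [l hl] : exists l : H, x_ @ \oo --> l.
  apply: nrm_complete => e e0.
  have [N] : exists N : nat, 4 / e ^+ 2 < N.+1%:R.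
    exists (Num.truncn (4 / e ^+ 2)).
    by rewrite truncnS_gt.
  rewrite ltr_pdivrMr ?exprn_gt0// => hN.
  exists N => p q Np Nq.
  have le1 (k : nat) : (N <= k)%N -> J (x_ k) - m < N.+1%:R^-1.
    move=> Nk; rewrite ltrBlDl (lt_le_trans (hx k))// lerD2l.
    by rewrite lef_pV2 ?posrE// ler_nat.
  have h4 : nrm (x_ p - x_ q) ^+ 2 < e ^+ 2.
    have : 4 * (N.+1%:R^-1) < e ^+ 2.
      by rewrite mulrC -ltr_pdivlMl ?invr_gt0// invrK.
    have aux (a b c d h : R) : a < h -> b < h -> c <= 2 * b + 2 * a ->
      4 * h < d -> c < d by lra.
    exact: aux (le1 _ Nq) (le1 _ Np) (Jmid _ _).
  by rewrite -(ltr_pXn2r (n := 2))// ?nnegrE ?nrm_ge0// ltW.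
exists l => y.
have var (t : R) : 0 <= 2 * t * (rdot l y - phi y) + t ^+ 2 * nrm y ^+ 2.
  have h n : - n.+1%:R^-1 <=
      2 * t * (rdot (x_ n) y - phi y) + t ^+ 2 * nrm y ^+ 2.
    have := lt_le_trans (hx n) (lerD (Jm (x_ n + t%:C%C *: y)) (lexx _)).
    rewrite /J -!rdotxx phiD phiZ rdotDl !rdotDr !rdotZl !rdotZr (rdotC y).
    set h := n.+1%:R^-1.
    have aux (a b c d k : R) : a - 2 * b <
      a + t * d + (t * d + t * (t * c)) - 2 * (b + t * k) + h ->
      - h <= 2 * t * (d - k) + t ^+ 2 * c by nra.
    exact: aux.
  have c1 : (- n.+1%:R^-1 : R) @[n --> \oo] --> (- 0 : R).
    by apply: cvgN; exact: cvg_harmonic.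
  have c2 : 2 * t * (rdot (x_ n) y - phi y) + t ^+ 2 * nrm y ^+ 2 @[n --> \oo]
      --> 2 * t * (rdot l y - phi y) + t ^+ 2 * nrm y ^+ 2.
    apply: cvgD; last exact: cvg_cst.
    apply: cvgM; first exact: cvg_cst.
    by apply: cvgB; [exact: cvg_rdot|exact: cvg_cst].
  rewrite -[0]oppr0 -(cvg_lim _ c1)// -(cvg_lim _ c2)//.
  apply: ler_lim; [exact: cvgP c1|exact: cvgP c2|].
  by exists 0%N => // n _; exact: h.
rewrite (rdotC y); apply/eqP; rewrite eq_sym -subr_eq0; apply/eqP.
have [y0|y0] := eqVneq (nrm y ^+ 2) 0.
  by have := var 1; have := var (-1); rewrite y0; lra.
set d := rdot l y - phi y; set b := nrm y ^+ 2.
have b0 : 0 < b by rewrite lt0r y0 sqr_ge0.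
(* the minimizer of the quadratic polynomial in t *)
have := var (- d / b); rewrite -/d -/b.
have -> : 2 * (- d / b) * d + (- d / b) ^+ 2 * b = - (d ^+ 2 / b) by field.
rewrite oppr_ge0 pmulr_lle0 ?invr_gt0// => h.
by apply/eqP; rewrite -sqrf_eq0 eq_le h sqr_ge0.
Qed.

Lemma adjoint_rdot (f g : H -> H) : linear f ->
  (forall x y, rdot (f x) y = rdot x (g y)) -> adjoint_of dot f g.
Proof.
move=> fl h x y; apply: dot_of_rdot => //.
by rewrite -(linear_scale _ _ fl) h.
Qed.

Lemma adjoint_rdotP (f g : H -> H) : adjoint_of dot f g ->
  forall x y, rdot (f x) y = rdot x (g y).
Proof. by move=> h x y; rewrite /rdot h. Qed.

Lemma adjoint_linear (f g : H -> H) :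
  adjoint_of dot f g -> linear g.
Proof.
move=> h a x y; apply: rdot_inj => z; rewrite !(rdotC _ z).
by rewrite /rdot -h !dotDr !dotZr !h.
Qed.

(** Elements of the commutant of M are only known to be bounded; their adjoints
    come from the Riesz representation of x |-> <f x, y>. *)
Lemma adjoint_exists (f : H -> H) : bounded_operator f ->
  exists2 g, bounded_operator g & adjoint_of dot f g.
Proof.
move=> /bounded_operatorP [fl [C C0 hC]].
have /choice[g hg] : forall y, exists z, forall x, rdot (f x) y = rdot x z.
  move=> y; apply: (@riesz (fun x => rdot (f x) y) (C * nrm y)).
  - by move=> x1 x2; rewrite linear_add// rdotDl.
  - by move=> a x; rewrite linear_scale// rdotZl.
  - move=> x; rewrite (le_trans (rdot_le_nrm _ _))// mulrAC.
    by rewrite ler_wpM2r ?nrm_ge0.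
have fg : adjoint_of dot f g by apply: adjoint_rdot => // x y; exact: hg.
exists g => //; apply/bounded_operatorP; split; first exact: adjoint_linear fg.
exists C => // y.
have [->|y0] := eqVneq (nrm (g y)) 0; first by rewrite mulr_ge0 ?nrm_ge0.
have gy : 0 < nrm (g y) by rewrite lt0r y0 nrm_ge0.
rewrite -(ler_pM2r gy) -expr2 -rdotxx -hg.
rewrite (le_trans (ler_norm _))// (le_trans (rdot_le_nrm _ _))//.
by rewrite mulrAC ler_wpM2r ?nrm_ge0.
Qed.

End RealInnerProduct.

(** * The spectral measure reduces the operator *)

Section SpectralMeasure.
Context {R : realType} {H : completeNormedModType R[i]}.
Variable dot : inner_product H.
Hypothesis dotE : induces_norm dot.
Variable T : @unbounded_operator R H.
Hypothesis Tsa : self_adjoint_unbounded dot T.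
Variable E : set (measurableTypeR R) -> H -> H.
Hypothesis ET : spectral_measure_of dot T E.

Local Notation "x '.*' y" := (rdot dot x y) (at level 40, format "x  .*  y").

Lemma pvmP A : measurable A -> orthogonal_projection dot (E A).
Proof. by case: ET => -[h _ _ _] _; exact: h. Qed.

Lemma pvm_bounded A : measurable A -> bounded_operator (E A).
Proof. by move=> /pvmP[[]]. Qed.

Lemma pvm_linear A : measurable A -> linear (E A).
Proof. by move=> /pvm_bounded[]. Qed.

Lemma pvm_idem A x : measurable A -> E A (E A x) = E A x.
Proof. by move=> /pvmP[_ h]; rewrite -[in RHS]h. Qed.

Lemma pvm_sym A x y : measurable A -> rdot dot (E A x) y = rdot dot x (E A y).
Proof. by move=> /pvmP[[_ h] _]; exact: adjoint_rdotP. Qed.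

Lemma pvm_form A x : measurable A -> rdot dot (E A x) x = nrm (E A x) ^+ 2.
Proof. by move=> mA; rewrite -(rdotxx dotE) [RHS]pvm_sym// pvm_idem// pvm_sym. Qed.

Lemma pvmI A B x : measurable A -> measurable B -> E (A `&` B) x = E A (E B x).
Proof. by move=> mA mB; case: ET => -[_ _ h _] _; rewrite h. Qed.

Lemma pvmT x : E setT x = x.
Proof. by case: ET => -[_ -> _ _] _. Qed.

Lemma spectral_distribution x :
  exists mu : {measure set (measurableTypeR R) -> \bar R},
    [/\ forall A, measurable A -> mu A = (nrm (E A x) ^+ 2)%:E,
        op_dom T x <-> (\int[mu]_l (l ^+ 2)%:E < +oo)%E &
        op_dom T x -> rdot dot (op_fun T x) x = \int[mu]_l l].
Proof.
have [_ /(_ x)[mu [h1 h2 h3]]] := ET.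
exists mu; split=> // [A mA|/h3 h]; first by rewrite h1// -pvm_form.
by rewrite /rdot h.
Qed.

Lemma pvm0 x : E set0 x = 0.
Proof.
have [mu [h _ _]] := spectral_distribution x.
have := h _ measurable0; rewrite measure0 => -[] /esym /eqP.
by rewrite sqrf_eq0 => /eqP /nrm_eq0.
Qed.

(** The difference of the two sides has norm zero by additivity of the scalar
    measure |E(.)x|^2. *)
Lemma pvm_setC A x : measurable A -> E A x + E (~` A) x = x.
Proof.
move=> mA; have mC := measurableC mA.
have [mu [h _ _]] := spectral_distribution x.
have e : nrm (E A x) ^+ 2 + nrm (E (~` A) x) ^+ 2 = nrm x ^+ 2.
  have : mu setT = (mu A + mu (~` A))%E.
    by rewrite -measureU ?setUCr// setICr.
  by rewrite !h// pvmT -EFinD => -[].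
apply/esym/eqP; rewrite -subr_eq0; apply/eqP/nrm_eq0/eqP.
have f1 := pvm_form x mA; have f2 := pvm_form x mC.
have f12 : E A x .* E (~` A) x = 0 by rewrite pvm_sym// -pvmI// setICr pvm0 rdot0r.
rewrite -sqrf_eq0 -(rdotxx dotE) rdotBl !rdotBr !rdotDl !rdotDr.
rewrite !(rdotC dot x (E _ x)) (rdotC dot (E (~` A) x) (E A x)) f1 f2 f12.
by rewrite !(rdotxx dotE) -e; apply/eqP; ring.
Qed.

Lemma pvm_nrm_le A x : measurable A -> nrm (E A x) <= nrm x.
Proof.
move=> mA; rewrite -(ler_pXn2r (n := 2))// ?nnegrE ?nrm_ge0//.
rewrite -{2}(pvm_setC x mA) -!(rdotxx dotE) !rdotDl !rdotDr.
rewrite [E A x .* E (~` A) x]pvm_sym// [E (~` A) x .* E A x]pvm_sym;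
  last exact: measurableC.
rewrite -!pvmI ?setICr ?setICl ?pvm0 ?rdot0r; try (by []); try exact: measurableC.
by rewrite addr0 add0r lerDl (rdotxx dotE) sqr_ge0.
Qed.

Lemma dom0 : op_dom T 0.
Proof.
have [mu [h1 h2 _]] := spectral_distribution 0.
apply/h2; rewrite (_ : integral _ _ _ = 0%E)//.
have m0 : mu setT = 0%E by rewrite h1// pvmT nrm0 expr0n.
apply: null_set_integral => //.
by apply/measurable_EFinP; exact: exprn_measurable.
Qed.

Lemma domP (a : R[i]) x y : op_dom T x -> op_dom T y ->
  op_dom T (a *: x + y) /\ op_fun T (a *: x + y) = a *: op_fun T x + op_fun T y.
Proof. by case: Tsa => _ h _; exact: h. Qed.

Lemma dom_add x y : op_dom T x -> op_dom T y -> op_dom T (x + y).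
Proof. by move=> hx hy; have [] := domP 1 hx hy; rewrite scale1r. Qed.

Lemma op_funD x y : op_dom T x -> op_dom T y ->
  op_fun T (x + y) = op_fun T x + op_fun T y.
Proof. by move=> hx hy; have [] := domP 1 hx hy; rewrite !scale1r. Qed.

Lemma op_fun0 : op_fun T 0 = 0.
Proof.
have := op_funD dom0 dom0; rewrite addr0 => /eqP.
by rewrite eq_sym -subr_eq0 addrK => /eqP.
Qed.

Lemma dom_scale (a : R[i]) x : op_dom T x -> op_dom T (a *: x).
Proof. by move=> hx; have [] := domP a hx dom0; rewrite addr0. Qed.

Lemma op_funZ (a : R[i]) x : op_dom T x -> op_fun T (a *: x) = a *: op_fun T x.
Proof. by move=> hx; have [] := domP a hx dom0; rewrite op_fun0 !addr0. Qed.

Lemma op_fun_sym x y : op_dom T x -> op_dom T y ->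
  op_fun T x .* y = x .* op_fun T y.
Proof.
move=> hx hy; have [_ _ /(_ y (op_fun T y)) [_ h]] := Tsa.
by rewrite /rdot h.
Qed.

Lemma dom_rdot_eq0 z : (forall y, op_dom T y -> z .* y = 0) -> z = 0.
Proof.
move=> h; have [dT _ _] := Tsa.
apply: nrm_eq0; apply/eqP; rewrite eq_le nrm_ge0 andbT leNgt.
apply/negP => z0.
have e0 : (0 : R[i]) < (nrm z)%:C%C by rewrite ltcR.
have zz : ball z (nrm z)%:C%C !=set0 by exists z; exact: ballxx.
have [y [/= By Dy]] := dT _ zz (ball_open _ _).
move: By; rewrite -ball_normE /ball_ /= normE ltcR => By.
have : (z - y) .* (z - y) < nrm z ^+ 2.
  by rewrite (rdotxx dotE) ltr_pXn2r// ?nnegrE ?nrm_ge0.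
rewrite !rdotBl !rdotBr (h _ Dy) (rdotC _ y) (h _ Dy) !(rdotxx dotE).
by have := sqr_ge0 (nrm y); lra.
Qed.

(** The measures |E(.)x|^2 are finite, and |l| <= 1 + l^2. *)
Lemma integrable_id (mu : {measure set (measurableTypeR R) -> \bar R}) (c : R) :
  mu setT = c%:E -> (\int[mu]_l (l ^+ 2)%:E < +oo)%E ->
  mu.-integrable setT (EFin \o (fun l : measurableTypeR R => l : R)).
Proof.
move=> muT h2.
have i1 : mu.-integrable setT
    (EFin \o (fun l : measurableTypeR R => 1 + l ^+ 2 : R)).
  rewrite (_ : _ \o _ =
      (EFin \o cst (1 : R)) \+ (EFin \o (fun l : R => l ^+ 2)))//.
  apply: integrableD => //.
    apply/integrableP; split; first exact/measurable_EFinP.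
    under eq_integral do rewrite /= normr1.
    by rewrite integral_cst//= muT mul1e ltry.
  apply/integrableP; split.
    by apply/measurable_EFinP; exact: exprn_measurable.
  by under eq_integral do rewrite /= ger0_norm ?sqr_ge0//.
apply: le_integrable i1 => //; first by apply/measurable_EFinP.
move=> x _ /=; rewrite lee_fin (ger0_norm (_ : 0 <= 1 + x ^+ 2)) ?addr_ge0 ?sqr_ge0//.
have := sqr_ge0 (`|x| - 1); rewrite sqrrB real_normK ?num_real//.
by have := normr_ge0 x; have := sqr_ge0 x; lra.
Qed.

(** The scalar measure of E(A)x is the restriction to A of that of x. *)
Lemma dom_pvm A x : measurable A -> op_dom T x -> op_dom T (E A x).
Proof.
move=> mA; have [mu [h1 h2 _]] := spectral_distribution x.
have [nu [k1 k2 _]] := spectral_distribution (E A x).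
move=> /h2 hx; apply/k2; apply: le_lt_trans hx.
have mC := measurableC mA.
have msq (D : set (measurableTypeR R)) :
    measurable_fun D (fun l : measurableTypeR R => (l ^+ 2)%:E).
  by apply/measurable_EFinP; apply: measurable_funX; exact: measurable_id.
rewrite (@ge0_negligible_integral _ _ _ nu _ (~` A))//; last first.
- by rewrite k1// -pvmI// setICl pvm0 nrm0 expr0n.
- by move=> l _; rewrite lee_fin sqr_ge0.
rewrite setTD setCK (@eq_measure_integral _ _ _ _ mu); last first.
  by move=> B mB BA; rewrite h1// k1// -pvmI// setIidl.
apply: ge0_subset_integral => //.
by move=> l _; rewrite lee_fin sqr_ge0.
Qed.

(** Additivity of the spectral integral over A and its complement. *)
Lemma form_pvm_setC A x : measurable A -> op_dom T x ->
  op_fun T x .* x = op_fun T (E A x) .* E A x +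
                    op_fun T (E (~` A) x) .* E (~` A) x.
Proof.
move=> mA Dx; have [mu [h1 h2 h3]] := spectral_distribution x.
have mC := measurableC mA.
have iT : mu.-integrable setT (EFin \o (fun l : measurableTypeR R => l : R)).
  by apply: (@integrable_id _ (nrm (E setT x) ^+ 2)); [exact: h1|exact/h2].
have key B : measurable B ->
    op_fun T (E B x) .* E B x = \int[mu]_(l in B) (l : R).
  move=> mB; have [nu [k1 k2 k3]] := spectral_distribution (E B x).
  have mCB := measurableC mB.
  have DB := dom_pvm mB Dx.
  rewrite k3//; congr fine.
  rewrite (@negligible_integral _ _ _ nu _ (~` B))//; last 2 first.
  - by apply: (@integrable_id _ (nrm (E setT (E B x)) ^+ 2)); [exact: k1|exact/k2].
  - by rewrite k1// -pvmI// setICl pvm0 nrm0 expr0n.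
  rewrite setTD setCK; apply: eq_measure_integral.
  by move=> S mS SB; rewrite h1// k1// -pvmI// setIidl.
rewrite h3// !key// -(setUv A); apply: Rintegral_setU => //.
- by rewrite setUv.
- by rewrite disj_set2E setICr.
Qed.

(** The decomposition of the form of T at E(A)x + E(~A)y leaves no room for
    cross terms, which are twice this number because T is symmetric. *)
Lemma form_pvm_orth A x y : measurable A -> op_dom T x -> op_dom T y ->
  op_fun T (E A x) .* E (~` A) y = 0.
Proof.
move=> mA Dx Dy; have mC := measurableC mA.
have Dx' := dom_pvm mA Dx; have Dy' := dom_pvm mC Dy.
have := form_pvm_setC mA (dom_add Dx' Dy').
rewrite !(linear_add _ _ (pvm_linear _))//.
rewrite !pvm_idem// -!pvmI// setICr setICl !pvm0 addr0 add0r.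
rewrite op_funD// rdotDl !rdotDr [op_fun T (E (~` A) y) .* E A x]op_fun_sym//.
rewrite (rdotC _ (E (~` A) y)); lra.
Qed.

(** Both sides have the same form against the dense domain of T, the cross terms
    being zero. *)
Lemma op_fun_pvm A x : measurable A -> op_dom T x ->
  op_fun T (E A x) = E A (op_fun T x).
Proof.
move=> mA Dx; have mC := measurableC mA.
apply/eqP; rewrite -subr_eq0; apply/eqP; apply: dom_rdot_eq0 => y Dy.
rewrite rdotBl pvm_sym// -{1}(pvm_setC y mA) rdotDr form_pvm_orth// addr0.
have Dx1 := dom_pvm mA Dx; have Dx2 := dom_pvm mC Dx.
rewrite -{2}(pvm_setC x mA) op_funD// rdotDl.
have := form_pvm_orth mC Dx Dy; rewrite setCK => ->.
by rewrite addr0 subrr.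
Qed.

(** The sign s serves both half-lines: s = 1 gives lower bounds of the form, and
    s = -1 upper bounds. *)
Lemma form_bound (s b : R) A x : measurable A -> (forall l, A l -> b <= s * l) ->
  op_dom T x -> E A x = x -> b * nrm x ^+ 2 <= s * (op_fun T x .* x).
Proof.
move=> mA bA Dx EAx; have [mu [h1 h2 h3]] := spectral_distribution x.
have mC := measurableC mA.
have iT : mu.-integrable setT (EFin \o (fun l : measurableTypeR R => l : R)).
  by apply: (@integrable_id _ (nrm (E setT x) ^+ 2)); [exact: h1|exact/h2].
have iA : mu.-integrable A (EFin \o (fun l : measurableTypeR R => l : R)).
  by apply: integrableS iT.
have muA : mu A = (nrm x ^+ 2)%:E by rewrite h1// EAx.
rewrite h3//.
have -> : \int[mu]_l l = \int[mu]_(l in A) (l : R).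
  congr fine; rewrite (@negligible_integral _ _ _ mu _ (~` A))//.
    by rewrite setTD setCK.
  by rewrite h1// -EAx -pvmI// setICl pvm0 nrm0 expr0n.
rewrite -RintegralZl//.
have -> : b * nrm x ^+ 2 = \int[mu]_(l in A) cst b l.
  by rewrite Rintegral_cst// muA.
apply: le_Rintegral => //.
- apply/integrableP; split; first exact/measurable_EFinP.
  under eq_integral do rewrite /=.
  by rewrite integral_cst//= muA -EFinM ltry.
- rewrite (_ : _ \o _ =
      (fun l => s%:E * (EFin \o (fun l : measurableTypeR R => l : R)) l)%E)//.
  exact: integrableZl.
Qed.

End SpectralMeasure.

(** * Spectral subspaces of bands, described by the operator alone *)

Section Affiliation.
Context {R : realType} {H : completeNormedModType R[i]}.
Variable dot : inner_product H.
Hypothesis dotE : induces_norm dot.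
Variable T : @unbounded_operator R H.
Hypothesis Tsa : self_adjoint_unbounded dot T.
Variable E : set (measurableTypeR R) -> H -> H.
Hypothesis ET : spectral_measure_of dot T E.

Local Notation "x '.*' y" := (rdot dot x y) (at level 40, format "x  .*  y").

Definition shifted (a : R) x := op_fun T x - a%:C%C *: x.

(** A description of the range of E[a-c,a+c] in terms of T alone: (T - a)^n x is
    defined and at most c^n |x|, for every n. *)
Definition shifted_orbit_bounded (a c : R) (x : H) := exists x_ : nat -> H,
  [/\ x_ 0%N = x, forall n, op_dom T (x_ n),
      forall n, x_ n.+1 = shifted a (x_ n) &
      forall n, nrm (x_ n) <= c ^+ n * nrm x].

Let band (a c : R) : set (measurableTypeR R) := `[a - c, a + c]%classic.

Lemma measurable_band a c : measurable (band a c).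
Proof. exact: measurable_itv. Qed.

Lemma dom_band a c x : E (band a c) x = x -> op_dom T x.
Proof.
move=> Ex; have [mu [h1 h2 _]] := spectral_distribution dotE ET x.
have mK := measurable_band a c; have mC := measurableC mK.
apply/h2.
have msq (D : set (measurableTypeR R)) :
    measurable_fun D (fun l : measurableTypeR R => (l ^+ 2)%:E).
  by apply/measurable_EFinP; apply: measurable_funX; exact: measurable_id.
rewrite (@ge0_negligible_integral _ _ _ mu _ (~` (band a c)))//; last first.
- by rewrite h1// -Ex -(pvmI ET)// setICl (pvm0 dotE ET) nrm0 expr0n.
- by move=> l _; rewrite lee_fin sqr_ge0.
rewrite setTD setCK.
pose b := (`|a - c| + `|a + c|) ^+ 2.
apply: (@le_lt_trans _ _ (\int[mu]_(l in band a c) (cst b%:E) l)%E).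
  apply: ge0_le_integral => //.
  - by move=> l _; rewrite lee_fin sqr_ge0.
  - move=> l; rewrite /band /= in_itv /= => /andP[l1 l2].
    rewrite lee_fin /b -[l ^+ 2]real_normK ?num_real// ler_pXn2r// ?nnegrE ?addr_ge0//.
    rewrite ler_norml; have := ler_norm (a + c); have := ler_norm (- (a - c)).
    rewrite normrN; have := normr_ge0 (a - c); have := normr_ge0 (a + c).
    by move=> *; apply/andP; split; lra.
by rewrite integral_cst// h1// -EFinM ltry.
Qed.

Lemma shiftedD a x y : op_dom T x -> op_dom T y ->
  shifted a (x + y) = shifted a x + shifted a y.
Proof.
by move=> Dx Dy; rewrite /shifted (op_funD Tsa)// scalerDr opprD addrACA.
Qed.

Lemma shiftedZ a (k : R[i]) x : op_dom T x -> shifted a (k *: x) = k *: shifted a x.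
Proof.
move=> Dx; rewrite /shifted (op_funZ dotE Tsa ET)// scalerBr !scalerA.
by rewrite [k * _]mulrC.
Qed.

Lemma shifted_sym a x y : op_dom T x -> op_dom T y ->
  shifted a x .* y = x .* shifted a y.
Proof.
by move=> Dx Dy; rewrite rdotBl rdotBr (op_fun_sym Tsa)// rdotZl rdotZr.
Qed.

Lemma shifted_pvm A a x : measurable A -> op_dom T x ->
  shifted a (E A x) = E A (shifted a x).
Proof.
move=> mA Dx; have lA := pvm_linear ET mA.
rewrite /shifted (op_fun_pvm dotE Tsa ET)//.
rewrite (linear_sub _ _ lA) (linear_scale _ _ lA).
reflexivity.
Qed.

Lemma shifted_form_bound a c x : E (band a c) x = x ->
  `|shifted a x .* x| <= c * nrm x ^+ 2.
Proof.
move=> Ex; have Dx := dom_band Ex; have mK := measurable_band a c.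
rewrite /shifted rdotBl rdotZl (rdotxx dotE).
have h1 := @form_bound _ _ _ dotE _ _ ET 1 (a - c) _ x mK.
have h2 := @form_bound _ _ _ dotE _ _ ET (-1) (- (a + c)) _ x mK.
have {}h1 : (a - c) * nrm x ^+ 2 <= 1 * (op_fun T x .* x).
  by apply: h1 => // l; rewrite /band /= in_itv /= mul1r => /andP[].
have {}h2 : - (a + c) * nrm x ^+ 2 <= -1 * (op_fun T x .* x).
  by apply: h2 => // l; rewrite /band /= in_itv /= mulN1r lerN2 => /andP[].
by rewrite ler_norml; apply/andP; split; lra.
Qed.

(** Polarization: a symmetric form bounded by c comes from an operator bounded
    by c. The form is evaluated at c x + y and c x - y with y = (T - a) x. *)
Lemma shifted_band_bound a c x : 0 < c -> E (band a c) x = x ->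
  nrm (shifted a x) <= c * nrm x.
Proof.
move=> c0 Ex; have mK := measurable_band a c.
have lK := pvm_linear ET mK.
have Dx := dom_band Ex; set y := shifted a x.
have Ey : E (band a c) y = y by rewrite /y -shifted_pvm// Ex.
have Dy := dom_band Ey.
pose x' := c%:C%C *: x.
have Ex' : E (band a c) x' = x' by rewrite /x' linear_scale// Ex.
have Dx' := dom_band Ex'.
have b1 : `|shifted a (x' + y) .* (x' + y)| <= c * nrm (x' + y) ^+ 2.
  by apply: shifted_form_bound; rewrite linear_add// Ex' Ey.
have b2 : `|shifted a (x' - y) .* (x' - y)| <= c * nrm (x' - y) ^+ 2.
  by apply: shifted_form_bound; rewrite linear_sub// Ex' Ey.
have Sy : shifted a (x' - y) = shifted a x' - shifted a y.
  have -> : - y = (-1) *: y by rewrite scaleN1r.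
  rewrite shiftedD//; last exact: (dom_scale dotE Tsa ET).
  by rewrite (shiftedZ _ _ Dy) scaleN1r.
have e1 : shifted a x' = c%:C%C *: y by rewrite /x' shiftedZ.
have e2 : shifted a y .* x' = y .* (c%:C%C *: y) by rewrite shifted_sym// e1.
rewrite -(ler_pXn2r (n := 2))// ?nnegrE ?mulr_ge0 ?nrm_ge0 ?(ltW c0)//.
rewrite -(ler_pM2l c0) exprMn.
move: b1 b2; rewrite Sy shiftedD// e1 !ler_norml -!(rdotxx dotE).
clearbody y; rewrite /x' in e2 *.
move: (shifted a y) e2 => q e2 /andP[_ b1] /andP[b2 _]; move: b1 b2.
rewrite !(rdotBl,rdotBr,rdotDl,rdotDr) e2 !rdotZl !rdotZr (rdotC _ y x).
rewrite !(rdotZr, rdotZl) in e2 *.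
rewrite !rdotNl; lra.
Qed.

Lemma band_orbit a c x : 0 < c -> E (band a c) x = x ->
  shifted_orbit_bounded a c x.
Proof.
move=> c0 Ex; exists (fun n => iter n (shifted a) x).
have mK := measurable_band a c.
have h n : E (band a c) (iter n (shifted a) x) = iter n (shifted a) x.
  elim: n => [//|n ih]; rewrite iterS -shifted_pvm ?ih//; exact: dom_band ih.
split=> // [n|n]; first exact: dom_band (h n).
elim: n => [|n ih]; first by rewrite expr0 mul1r.
rewrite iterS (le_trans (shifted_band_bound c0 (h n)))// exprS -mulrA.
by rewrite ler_pM2l.
Qed.

(** On the range of E(A) the powers of T - a grow at least like c'^n, and E(A)
    commutes with T, so the component E(A)x of an orbit that grows at most like
    c^n vanishes. *)
Lemma orbit_pvm0 a c c' x A : 0 <= c -> c < c' -> measurable A ->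
  (forall y, op_dom T y -> E A y = y -> c' * nrm y ^+ 2 <= `|shifted a y .* y|) ->
  shifted_orbit_bounded a c x -> E A x = 0.
Proof.
move=> c0 cc' mA lb [x_ [x0 Dx xS xb]].
have c'0 : 0 < c' by exact: le_lt_trans cc'.
have lbn y : op_dom T y -> E A y = y -> c' * nrm y <= nrm (shifted a y).
  move=> Dy Ey; have [->|y0] := eqVneq (nrm y) 0; first by rewrite mulr0 nrm_ge0.
  have py : 0 < nrm y by rewrite lt0r y0 nrm_ge0.
  rewrite -(ler_pM2r py) -mulrA -expr2 (le_trans (lb _ Dy Ey))//.
  exact: (rdot_le_nrm dotE).
have low n : c' ^+ n * nrm (E A x) <= nrm (E A (x_ n)).
  elim: n => [|n ih]; first by rewrite expr0 mul1r x0.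
  rewrite exprS -mulrA (@le_trans _ _ (c' * nrm (E A (x_ n))))//.
    by rewrite ler_pM2l.
  rewrite xS -shifted_pvm//; apply: lbn; first exact: (dom_pvm dotE ET).
  exact: (pvm_idem ET).
have up n : nrm (E A x) <= (c / c') ^+ n * nrm x.
  rewrite expr_div_n mulrAC ler_pdivlMr ?exprn_gt0// mulrC.
  by rewrite (le_trans (low n))// (le_trans (pvm_nrm_le dotE ET _ mA)).
apply: nrm_eq0; apply/eqP; rewrite eq_le nrm_ge0 andbT.
have cv : (c / c') ^+ n * nrm x @[n --> \oo] --> 0 * nrm x.
  apply: cvgM; last exact: cvg_cst.
  apply: cvg_expr; rewrite ger0_norm ?divr_ge0 ?(ltW c'0)//.
  by rewrite ltr_pdivrMr// mul1r.
rewrite -(mul0r (nrm x)) -(cvg_lim _ cv)//.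
by apply: limr_ge; [exact: cvgP cv|apply: nearW].
Qed.

Lemma pvm_bigcup0 (F : nat -> set (measurableTypeR R)) x :
  (forall n, measurable (F n)) -> (forall n, E (F n) x = 0) ->
  E (\bigcup_n F n) x = 0.
Proof.
move=> mF F0; have [mu [h1 _ _]] := spectral_distribution dotE ET x.
have mU : measurable (\bigcup_n F n) by exact: bigcupT_measurable.
have : mu.-negligible (\bigcup_n F n).
  apply: negligible_bigcup => n; exists (F n); split => //.
  by rewrite h1// F0 nrm0 expr0n.
move=> /(negligibleP _ mU) /(etrans (esym (h1 _ mU))) [] /eqP.
by rewrite sqrf_eq0 => /eqP /nrm_eq0.
Qed.

(** The complement of the band is a countable union of the half-lines at distance
    c + 1/(n+1) from a, and E of each of them kills x: there the form of T - a
    is definite, with lower bound c + 1/(n+1). *)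
Lemma orbit_band a c x : 0 < c -> shifted_orbit_bounded a c x ->
  E (band a c) x = x.
Proof.
move=> c0 xo.
pose L n : set (measurableTypeR R) := `[a + c + n.+1%:R^-1, +oo[%classic.
pose L' n : set (measurableTypeR R) := `]-oo, a - c - n.+1%:R^-1]%classic.
have p n : (0 : R) < n.+1%:R^-1 by rewrite invr_gt0.
have L0 n : E (L n) x = 0.
  have mL : measurable (L n) by exact: measurable_itv.
  apply: (@orbit_pvm0 a c (c + n.+1%:R^-1)) => //; [exact: ltW|by rewrite ltrDl|].
  move=> y Dy Ey.
  have := @form_bound _ _ _ dotE _ _ ET 1 (a + c + n.+1%:R^-1) _ y mL.
  move=> /(_ _ Dy Ey) h.
  rewrite (le_trans _ (ler_norm _))// /shifted rdotBl rdotZl (rdotxx dotE).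
  have {h} : (a + c + n.+1%:R^-1) * nrm y ^+ 2 <= 1 * (op_fun T y .* y).
    by apply: h => l; rewrite /L /= in_itv /= andbT mul1r.
  move: (n.+1%:R^-1) (nrm y ^+ 2) (op_fun T y .* y) => d v q; lra.
have L'0 n : E (L' n) x = 0.
  have mL : measurable (L' n) by exact: measurable_itv.
  apply: (@orbit_pvm0 a c (c + n.+1%:R^-1)) => //; [exact: ltW|by rewrite ltrDl|].
  move=> y Dy Ey.
  have := @form_bound _ _ _ dotE _ _ ET (-1) (- (a - c - n.+1%:R^-1)) _ y mL.
  move=> /(_ _ Dy Ey) h.
  rewrite -normrN (le_trans _ (ler_norm _))// /shifted rdotBl rdotZl (rdotxx dotE).
  have {h} : - (a - c - n.+1%:R^-1) * nrm y ^+ 2 <= -1 * (op_fun T y .* y).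
    by apply: h => l; rewrite /L' /= in_itv /= mulN1r lerN2.
  move: (n.+1%:R^-1) (nrm y ^+ 2) (op_fun T y .* y) => d v q; lra.
have mC := measurableC (measurable_band a c).
have sub : ~` band a c `<=` (\bigcup_n L n) `|` (\bigcup_n L' n).
  move=> l; rewrite /band /= in_itv /= => /negP; rewrite negb_and -!ltNge.
  have ex (d : R) : 0 < d -> exists n, n.+1%:R^-1 <= d.
    move=> d0; exists (Num.truncn d^-1); rewrite invf_ple ?posrE//.
    by rewrite ltW// truncnS_gt.
  move=> /orP[h|h]; [right|left].
    have [|n hn] := ex (a - c - l); first by rewrite subr_gt0.
    have aux (q k d : R) : d <= q - k -> k <= q - d by lra.
    by exists n => //; rewrite /L' /= in_itv /=; exact: aux hn.
  have [|n hn] := ex (l - (a + c)); first by rewrite subr_gt0.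
  have aux (q k d : R) : d <= k - q -> q + d <= k by lra.
  by exists n => //; rewrite /L /= in_itv /= andbT; exact: aux hn.
have mL : measurable (\bigcup_n L n).
  by apply: bigcupT_measurable => n; exact: measurable_itv.
have mL' : measurable (\bigcup_n L' n).
  by apply: bigcupT_measurable => n; exact: measurable_itv.
have z1 : E (\bigcup_n L n) x = 0.
  by apply: pvm_bigcup0 => // n; exact: measurable_itv.
have z2 : E (\bigcup_n L' n) x = 0.
  by apply: pvm_bigcup0 => // n; exact: measurable_itv.
have z3 : E (~` band a c) x = 0.
  have := pvm_bigcup0 (x := x) (F := bigcup2 (\bigcup_n L n) (\bigcup_n L' n)).
  rewrite bigcup2E => z.
  have {}z : E (\bigcup_n L n `|` \bigcup_n L' n) x = 0.
    apply: z => -[|[|n]] //=; exact: (pvm0 dotE ET).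
  rewrite -(setIidl sub) (pvmI ET)//; last exact: measurableU.
  by rewrite z (linearP0 (pvm_linear ET mC)).
by rewrite -[RHS](pvm_setC dotE ET x (measurable_band a c)) z3 addr0.
Qed.

End Affiliation.

(** * The spectral projections lie in the von Neumann algebra *)

Section Commutants.
Context {R : realType} {H : completeNormedModType R[i]}.

Lemma commutant_comb (S : set (H -> H)) (a b : R[i]) (f g : H -> H) :
  (forall q, S q -> linear q) -> commutant S f -> commutant S g ->
  commutant S (fun y => a *: f y + b *: g y).
Proof.
move=> Sl [[fl fc] fM] [[gl gc] gM]; split.
  split.
    move=> c y z /=; rewrite (fl c y z) (gl c y z) !scalerDr !scalerA.
    by rewrite [a * c]mulrC [b * c]mulrC addrACA; reflexivity.
  by move=> y; apply: cvgD; apply: cvgZ; by [exact: cvg_cst|exact: fc|exact: gc].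
move=> q Mq; have ql := Sl _ Mq.
apply: funext => y /=.
rewrite (linear_add _ _ ql) !(linear_scale _ _ ql).
by rewrite -[q (f y)]/((q \o f) y) -[q (g y)]/((q \o g) y) -(fM _ Mq) -(gM _ Mq).
Qed.

Lemma commutant_subalgebra (S : set (H -> H)) : (forall q, S q -> linear q) ->
  unital_subalgebra (commutant S).
Proof.
move=> Sl; split.
- by split=> //; split=> // y; exact: cvg_id.
- move=> a f g Sf Sg; rewrite (_ : a *: f + g = fun y => a *: f y + 1 *: g y).
    exact: (commutant_comb _ _ Sl).
  by apply: funext => y; rewrite scale1r.
- move=> f g [[fl fc] fS] [[gl gc] gS]; split.
    split; first by move=> a x y /=; rewrite (gl a x y) (fl a (g x) (g y)).
    by move=> x; apply: continuous_comp; [exact: gc|exact: fc].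
  move=> q Sq; apply: funext => x /=.
  by rewrite -[g (q x)]/((g \o q) x) gS//= -[f (q _)]/((f \o q) _) fS.
Qed.

End Commutants.

Section Commutation.
Context {R : realType} {H : completeNormedModType R[i]}.
Variable dot : inner_product H.
Hypothesis dotE : induces_norm dot.
Variable T : @unbounded_operator R H.
Hypothesis Tsa : self_adjoint_unbounded dot T.
Variable E : set (measurableTypeR R) -> H -> H.
Hypothesis ET : spectral_measure_of dot T E.
Variable M : set (H -> H).
Hypothesis vnM : von_neumann_algebra dot M.
Hypothesis TM : affiliated dot M T.

Local Notation "x '.*' y" := (rdot dot x y) (at level 40, format "x  .*  y").

Lemma unitary_nrm u x : unitary dot u -> nrm (u x) = nrm x.
Proof.
move=> [_ [v [_ uv _ vu]]].
apply/eqP; rewrite -(eqrXn2 (n := 2))// ?nrm_ge0// -!(rdotxx dotE).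
by rewrite (adjoint_rdotP uv) -[v (u x)]/((v \o u) x) vu.
Qed.

(** u carries the orbit of x under T - a to that of u x. *)
Lemma unitary_band u a c x : commutant M u -> unitary dot u -> 0 < c ->
  E `[a - c, a + c]%classic x = x -> E `[a - c, a + c]%classic (u x) = u x.
Proof.
move=> uM uu c0 Ex; have [TD Tu] := TM uM uu.
have [[ul _] _] := uu.
have [x_ [x0 Dx xS xb]] := band_orbit dotE Tsa ET c0 Ex.
apply: (orbit_band dotE Tsa ET c0); exists (u \o x_); split=> //=.
- by rewrite x0.
- by move=> n; apply/TD.
- move=> n; rewrite xS /shifted Tu//.
  by rewrite (linear_sub _ _ ul) (linear_scale _ _ ul); reflexivity.
- by move=> n; rewrite !unitary_nrm.
Qed.

(** The inverse of u preserves the range of a band projection as well, so the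
    projection reduces u. *)
Lemma unitary_band_comm u a c x : commutant M u -> unitary dot u -> 0 < c ->
  E `[a - c, a + c]%classic (u x) = u (E `[a - c, a + c]%classic x).
Proof.
move=> uM uu c0; have [ub [v [vb uv uvid vuid]]] := uu.
have vu : adjoint_of dot v u.
  by move=> y z; rewrite dotC -uv -dotC.
have vM : commutant M v.
  split=> // g gM; apply: funext => y /=.
  have [_ /(_ _ gM) h] := uM.
  rewrite -[in LHS](_ : u (v y) = y); last by rewrite -[LHS]/((u \o v) y) uvid.
  rewrite -[g (u (v y))]/((g \o u) (v y)) -h /=.
  by rewrite -[LHS]/((v \o u) (g (v y))) vuid.
have uuv : unitary dot v by split=> //; exists u.
have mK : measurable (`[a - c, a + c]%classic : set (measurableTypeR R)).
  exact: measurable_itv.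
set P := E _ in mK *; have Pi y : P (P y) = P y by exact: (pvm_idem ET).
have Psym y z : P y .* z = y .* P z by exact: (pvm_sym ET).
have Pu y : P (u (P y)) = u (P y) by exact: unitary_band.
have Pv y : P (v (P y)) = v (P y) by exact: unitary_band.
rewrite -[RHS]Pu; apply: (rdot_inj dotE) => z.
rewrite Psym (adjoint_rdotP uv) Psym (adjoint_rdotP uv).
by rewrite Psym Pv.
Qed.

(** The Borel sets A for which E(A) commutes with B form a sigma-algebra, and the
    half-lines [r, +oo[ are increasing unions of bands. *)
Lemma comm_borel (B : H -> H) : bounded_operator B ->
  (forall a c x, 0 < c ->
     E `[a - c, a + c]%classic (B x) = B (E `[a - c, a + c]%classic x)) ->
  forall A x, measurable A -> E A (B x) = B (E A x).
Proof.
move=> Bb Bitv; have [Bl _] := Bb.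
pose G : set (set (measurableTypeR R)) :=
  [set A | measurable A /\ forall x, E A (B x) = B (E A x)].
have GI A1 A2 : G A1 -> G A2 -> G (A1 `&` A2).
  move=> [m1 h1] [m2 h2]; split; first exact: measurableI.
  by move=> x; rewrite !(pvmI ET)// h2 h1.
have GC A : G A -> G (~` A).
  move=> [mA h]; split; first exact: measurableC.
  move=> x; apply: (addrI (E A (B x))); rewrite (pvm_setC dotE ET)//.
  by rewrite h -(linear_add _ _ Bl) (pvm_setC dotE ET).
have GU A1 A2 : G A1 -> G A2 -> G (A1 `|` A2).
  by move=> g1 g2; rewrite -[_ `|` _]setCK setCU; apply/GC/GI; exact: GC.
have G0 : G set0.
  by split=> // x; rewrite !(pvm0 dotE ET) (linearP0 Bl).
have GD (F : nat -> set (measurableTypeR R)) : trivIset setT F ->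
    (forall n, G (F n)) -> G (\bigcup_n F n).
  move=> tF gF; have mF n : measurable (F n) by case: (gF n).
  split=> [|x]; first exact: bigcupT_measurable.
  have [[_ _ _ cE] _] := ET.
  have c1 := cE F mF tF (B x).
  have c2 := cvg_lin Bb (cE F mF tF x).
  have e : series (fun n => E (F n) (B x)) =
      fun n => B (series (fun k => E (F k) x) n).
    apply: funext => n; rewrite /series /=.
    elim: n => [|n ih]; first by rewrite !big_geq// (linearP0 Bl).
    rewrite !big_nat_recr//= ih (linear_add _ _ Bl).
    by case: (gF n) => _ ->.
  by rewrite e in c1; exact: (cvg_unique _ c1 c2).
have Gsigma : sigma_algebra setT G.
  split => //; first by move=> A gA; rewrite setTD; exact: GC.
  move=> F gF; rewrite seqDU_bigcup_eq; apply: GD; first exact: trivIset_seqDU.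
  move=> n; rewrite /seqDU setDE; apply: GI => //; apply: GC.
  by apply: (big_ind G) => //.
(* the band centered at r + (n + 1), of half-width n + 1 *)
have Gray (r : R) : G `[r, +oo[%classic.
  rewrite (_ : `[r, +oo[%classic =
      \bigcup_n `[r, r + n.+1%:R *+ 2]%classic); last first.
    apply/seteqP; split=> l /=.
      rewrite in_itv /= andbT => rl; exists (Num.truncn (l - r)) => //=.
      rewrite in_itv /= rl /=.
      have := truncnS_gt (l - r); move: (_.+1%:R) => d h.
      have : 0 <= l - r by rewrite subr_ge0.
      by rewrite mulr2n; lra.
    by move=> [n _ /=]; rewrite !in_itv /= andbT => /andP[].
  have [_ _ GSU] := Gsigma.
  apply: GSU => n; split; first exact: measurable_itv.
  move=> x; have := Bitv (r + n.+1%:R) n.+1%:R x.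
  by rewrite addrK -addrA -mulr2n; apply.
move=> A x mA; suff [] : G A by [].
have mA' := mA; rewrite RGenCInfty.measurableE in mA'.
by apply: (smallest_sub _ _ mA') => // _ [r ->].
Qed.

Lemma comm_unitary A u x : measurable A -> commutant M u -> unitary dot u ->
  E A (u x) = u (E A x).
Proof.
move=> mA uM uu; apply: comm_borel => //; first by case: uu.
by move=> *; exact: unitary_band_comm.
Qed.

Lemma i_sq (x : H) : 'i%C *: ('i%C *: x) = - x.
Proof. by rewrite scalerA -expr2 sqr_i scaleN1r. Qed.

(** w |-> k g w + y contracts by the factor 1/2, and the iterates from 0 converge
    to its fixed point. *)
Lemma shift_solve (g : H -> H) (k : R[i]) (y : H) : linear g ->
  (forall x : H, nrm (k *: x) = nrm x) ->
  (forall x, nrm (g x) <= 2^-1 * nrm x) ->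
  exists w, w = k *: g w + y.
Proof.
move=> gl kn g2.
pose F w := k *: g w + y.
pose w_ n := iter n F 0.
have FB a b : F a - F b = k *: g (a - b).
  rewrite /F (linear_sub _ _ gl) scalerBr opprD addrACA subrr addr0.
  reflexivity.
have d1 n : nrm (w_ n.+1 - w_ n) <= (2^-1) ^+ n * nrm y.
  elim: n => [|n ih].
    by rewrite /w_ /= /F (linearP0 gl) scaler0 add0r subr0 expr0 mul1r.
  rewrite [w_ n.+2]/w_ iterS -/(w_ n.+1) [in X in _ - X]/w_ iterS -/(w_ n).
  rewrite FB kn (le_trans (g2 _))// exprS -mulrA ler_wpM2l//.
have d2 n m : nrm (w_ (n + m)%N - w_ n) <=
    2 * (2^-1) ^+ n * nrm y * (1 - (2^-1) ^+ m).
  elim: m => [|m ih]; first by rewrite addn0 subrr nrm0 expr0 subrr mulr0.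
  have e : w_ (n + m.+1)%N - w_ n =
      (w_ (n + m).+1 - w_ (n + m)%N) + (w_ (n + m)%N - w_ n).
    by rewrite addrA subrK addnS.
  rewrite e (le_trans (nrmD _ _))//.
  have := lerD (d1 (n + m)%N) ih; move/le_trans; apply.
  rewrite exprD exprS.
  move: (2^-1 ^+ n) (2^-1 ^+ m) (nrm y) => p q r; lra.
have d3 n m : (n <= m)%N -> nrm (w_ m - w_ n) <= 2 * (2^-1) ^+ n * nrm y.
  move=> nm; rewrite -(subnKC nm) (le_trans (d2 _ _))//.
  have p0 : 0 <= (2^-1 : R) ^+ (m - n) by rewrite exprn_ge0.
  have q0 : 0 <= 2 * (2^-1) ^+ n * nrm y by rewrite !mulr_ge0 ?nrm_ge0 ?exprn_ge0.
  by apply: ler_piMr => //; rewrite gerBl.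
have geo0 : 2 * (2^-1) ^+ n * nrm y @[n --> \oo] --> (0 : R).
  rewrite [X in _ --> X](_ : _ = 2 * 0 * nrm y); last by rewrite mulr0 mul0r.
  apply: cvgM; last exact: cvg_cst.
  apply: cvgM; first exact: cvg_cst.
  by apply: cvg_expr; rewrite ger0_norm// invf_lt1// ltr1n.
have [l hl] : exists l : H, w_ @ \oo --> l.
  apply: nrm_complete => e e0.
  have e2 : 0 < e / 2 by rewrite divr_gt0.
  have /cvgrPdist_lt /(_ _ e2) [N _ hN] := geo0.
  have hN' : 2 * (2^-1) ^+ N * nrm y < e / 2.
    by have := hN N (leqnn _); rewrite sub0r normrN; apply: le_lt_trans (ler_norm _).
  exists N => m n Nm Nn.
  have -> : w_ m - w_ n = (w_ m - w_ N) - (w_ n - w_ N).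
    by rewrite opprB addrA subrK.
  rewrite (le_lt_trans (nrmB _ _))// [e]splitr ltrD//.
    exact: le_lt_trans (d3 _ _ Nm) hN'.
  exact: le_lt_trans (d3 _ _ Nn) hN'.
exists l; apply/eqP; rewrite -subr_eq0; apply/eqP/nrm_eq0/eqP.
rewrite eq_le nrm_ge0 andbT; apply/ler_addgt0Pl => e e0; rewrite addr0.
have e3 : 0 < e / 3 by rewrite divr_gt0.
have /cvg_nrmP /(_ _ e3) [N1 _ h1] := hl.
have a1 := h1 N1 (leqnn _).
have a2 := h1 N1.+1 (leqnSn _).
have -> : l - (k *: g l + y) = (l - w_ N1.+1) - k *: g (l - w_ N1).
  rewrite -FB /F [w_ N1.+1]/w_ iterS -/(w_ N1) /F opprB addrA subrK.
  reflexivity.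
rewrite (le_trans (nrmB _ _))// kn.
have aux (p q r : R) :
    0 <= p -> p < e / 3 -> q < e / 3 -> r <= 2^-1 * p -> q + r <= e.
  by lra.
exact: aux (nrm_ge0 _) a1 a2 (g2 _).
Qed.

(** g + s is onto because s (g + s) differs from -1 by a contraction, and it is
    bounded below by 1 because |(g + s) w|^2 = |g w|^2 + |w|^2 for self-adjoint
    g. *)
Lemma resolvent (g : H -> H) (s : R[i]) : s = 'i%C \/ s = - 'i%C ->
  commutant M g -> adjoint_of dot g g -> (forall y, nrm (g y) <= 2^-1 * nrm y) ->
  exists h, [/\ commutant M h, forall y, g (h y) + s *: h y = y &
    forall w, h (g w + s *: w) = w].
Proof.
move=> si gM gg g2; have [gb gc] := gM; have [gl _] := gb.
have s2 : s ^+ 2 = -1 by case: si => ->; rewrite ?sqrrN sqr_i.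
have sn (y : H) : nrm (s *: y) = nrm y by case: si => ->; rewrite ?scaleNr ?nrmN nrmi.
have sa y z : (s *: y) .* z = - (y .* (s *: z)).
  by case: si => ->; rewrite ?scaleNr ?rdotNl ?rdotNr rdoti.
have /choice[h hh] : forall y, exists w, g w + s *: w = y.
  move=> y; have [w hw] := shift_solve (- (s *: y)) gl sn g2.
  exists w; rewrite [X in s *: X]hw scalerBr !scalerA -expr2 s2 !scaleN1r opprK.
  by rewrite addrA subrr add0r.
have lower w : nrm w <= nrm (g w + s *: w).
  rewrite -(ler_pXn2r (n := 2))// ?nnegrE ?nrm_ge0//.
  rewrite -[X in _ <= X](rdotxx dotE) rdotDl !rdotDr !(rdotxx dotE) sn.
  have e : (s *: w) .* g w = - (g w .* (s *: w)).
    by rewrite sa -(linear_scale _ _ gl) (adjoint_rdotP gg).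
  by rewrite e; have := sqr_ge0 (nrm (g w)); lra.
have gsl : linear (fun w => g w + s *: w).
  move=> a y z /=; rewrite (gl a y z) !scalerDr !scalerA [s * a]mulrC.
  by rewrite addrACA; reflexivity.
have inj w w' : g w + s *: w = g w' + s *: w' -> w = w'.
  move=> e; apply/eqP; rewrite -subr_eq0; apply/eqP/nrm_eq0/eqP.
  rewrite eq_le nrm_ge0 andbT (le_trans (lower _))//.
  by rewrite (linear_sub _ _ gsl) e subrr nrm0.
exists h; split=> // [|w]; last exact: inj.
split.
  apply/bounded_operatorP; split.
    move=> a y z; apply: inj; rewrite hh (gsl a) !hh; reflexivity.
  by exists 1 => // y; rewrite mul1r -[in leRHS](hh y).
move=> f Mf; have [MB _ _] := vnM; have [fl _] := MB _ Mf.
have [_ /(_ _ Mf) gf] := gM.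
apply: funext => y /=; apply: inj; rewrite hh.
rewrite -[g (f _)]/((g \o f) _) gf /= -(linear_scale _ _ fl) -(linear_add _ _ fl).
by rewrite hh.
Qed.

(** A self-adjoint contraction g in the commutant has there the unitary Cayley
    transform (g - i)(g + i)^-1 = 1 - 2i (g + i)^-1, and whatever commutes with
    the latter commutes with g. *)
Lemma comm_selfadjoint A g x : measurable A -> commutant M g ->
  adjoint_of dot g g -> (forall y, nrm (g y) <= 2^-1 * nrm y) ->
  E A (g x) = g (E A x).
Proof.
move=> mA gM gg g2; have [[gl _] gc] := gM.
have Ml q : M q -> linear q by have [MB _ _] := vnM; case/MB.
have [h [hM hr hl]] := resolvent (or_introl erefl) gM gg g2.
have [k [kM kr kl]] := resolvent (or_intror erefl) gM gg g2.
pose u y := g (h y) - 'i%C *: h y.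
pose v y := g (k y) + 'i%C *: k y.
have uE y : u y = y - ('i%C + 'i%C) *: h y.
  by rewrite /u -[X in _ = X - _](hr y) scalerDl opprD addrA addrK.
have vE y : v y = y + ('i%C + 'i%C) *: k y.
  by rewrite /v -[X in _ = X + _](kr y) scalerDl addrA scaleNr subrK.
have idM : commutant M id.
  by split=> //; split=> // y; exact: cvg_id.
have uM : commutant M u.
  rewrite (_ : u = fun y => 1 *: id y + (- ('i%C + 'i%C)) *: h y).
    exact: (commutant_comb _ _ Ml).
  by apply: funext => y; rewrite uE scaleNr scale1r.
have vM : commutant M v.
  rewrite (_ : v = fun y => 1 *: id y + ('i%C + 'i%C) *: k y).
    exact: (commutant_comb _ _ Ml).
  by apply: funext => y; rewrite vE scale1r.
(* v = (g + i)(g - i)^-1 is both the inverse and the adjoint of u *)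
have uu : unitary dot u.
  split; first by case: uM.
  exists v; split; first by case: vM.
  - apply: adjoint_rdot; first by case: uM => -[].
    move=> y z; rewrite /u /v -[in RHS](hr y) -[in LHS](kr z).
    rewrite scaleNr !(rdotBl, rdotBr, rdotDl, rdotDr).
    move: (h y) (k z) => p q.
    have e : ('i%C *: p) .* g q = - (g p .* ('i%C *: q)).
      by rewrite rdoti (adjoint_rdotP gg) (linear_scale _ _ gl).
    rewrite !rdotNr !rdotNl e; lra.
  - apply: funext => y /=; rewrite /u; have -> : h (v y) = k y by exact: hl.
    by rewrite -[RHS](kr y) scaleNr.
  - apply: funext => y /=; rewrite /v; have -> : k (u y) = h y.
      by rewrite -[RHS]kl scaleNr.
    by rewrite -[RHS](hr y).
have Eu y : E A (u y) = u (E A y) by exact: comm_unitary.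
have EAl : linear (E A) by exact: (pvm_linear ET).
have Eh y : E A (h y) = h (E A y).
  have := Eu y; rewrite !uE (linear_sub _ _ EAl) (linear_scale _ _ EAl).
  move=> /addrI /oppr_inj /scalerI; apply.
  by rewrite -mulr2n -mulr_natl mulf_neq0// ?pnatr_eq0// neq0Ci.
set w := g x + 'i%C *: x.
have ew : h w = x by exact: hl.
have : g (E A x) + 'i%C *: E A x = E A w.
  by rewrite -[x]ew Eh hr.
rewrite /w (linear_add _ _ EAl) (linear_scale _ _ EAl) => /addIr ->.
by [].
Qed.

(** A von Neumann algebra contains the spectral projections of an affiliated
    operator: every element of the commutant is a combination of two
    self-adjoint contractions, namely multiples of its real and imaginary
    parts. *)
Lemma pvm_mem A : measurable A -> M (E A).
Proof.
move=> mA; have [MB Madj MM] := vnM.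
have EAb := pvm_bounded ET mA; have EAl := pvm_linear ET mA.
rewrite -MM; split=> // f [fb fM]; have [fl _] := fb.
have [f' f'b ff'] := adjoint_exists dotE fb; have [f'l _] := f'b.
have f'f : adjoint_of dot f' f by move=> y z; rewrite dotC -ff' -dotC.
have f'M g : M g -> f' \o g = g \o f'.
  move=> gM; have [g' g'M gg'] := Madj _ gM.
  have := fM _ g'M => fg; apply: funext => y /=; apply: (rdot_inj dotE) => z.
  rewrite (adjoint_rdotP f'f) (adjoint_rdotP gg') -[g' (f z)]/((g' \o f) z) -fg /=.
  by rewrite (adjoint_rdotP gg') (adjoint_rdotP f'f).
have /bounded_operatorP [_ [C C0 hC]] := fb.
have /bounded_operatorP [_ [C' C'0 hC']] := f'b.
have Ml q : M q -> linear q by case/MB.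
(* the factor t makes both parts contractions by 1/2 *)
pose t : R := (2 * (C + C' + 1))^-1.
have CC : 0 < C + C' + 1 by rewrite ltr_wpDl// addr_ge0.
have t0 : 0 < t by rewrite invr_gt0 mulr_gt0.
have tC : t * (C + C') <= 2^-1.
  rewrite /t invfM -mulrA ler_piMr// mulrC ler_pdivrMr// mul1r.
  by rewrite lerDl.
have bound (y z w : H) : nrm y <= C * nrm w -> nrm z <= C' * nrm w ->
    t * (nrm y + nrm z) <= 2^-1 * nrm w.
  move=> yw zw; rewrite (@le_trans _ _ (t * (C + C') * nrm w))//.
    by rewrite -mulrA ler_pM2l// mulrDl lerD.
  by rewrite ler_wpM2r ?nrm_ge0.
pose g1 y := t%:C%C *: (f y + f' y).
pose g2 y := t%:C%C *: ('i%C *: (f y - f' y)).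
have fM' : commutant M f by [].
have f'M' : commutant M f' by [].
have g1M : commutant M g1.
  rewrite (_ : g1 = fun y => t%:C%C *: f y + t%:C%C *: f' y).
    exact: (commutant_comb _ _ Ml).
  by apply: funext => y; rewrite /g1 scalerDr.
have g2M : commutant M g2.
  rewrite (_ : g2 = fun y => (t%:C%C * 'i%C) *: f y + (- (t%:C%C * 'i%C)) *: f' y).
    exact: (commutant_comb _ _ Ml).
  by apply: funext => y; rewrite /g2 scalerA scalerBr scaleNr.
have g1s : adjoint_of dot g1 g1.
  apply: adjoint_rdot; first by case: g1M => -[].
  move=> y z; rewrite rdotZl rdotZr rdotDl rdotDr.
  by rewrite (adjoint_rdotP ff') (adjoint_rdotP f'f) addrC.
have g2s : adjoint_of dot g2 g2.
  apply: adjoint_rdot; first by case: g2M => -[].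
  move=> y z; rewrite rdotZl rdotZr rdoti; congr (_ * _).
  rewrite rdotBl (adjoint_rdotP ff') (adjoint_rdotP f'f).
  by rewrite (linear_scale _ _ fl) (linear_scale _ _ f'l) scalerBr rdotBr opprB.
have g1n y : nrm (g1 y) <= 2^-1 * nrm y.
  rewrite nrmZ gtr0_norm// (le_trans _ (bound _ _ _ (hC y) (hC' y)))//.
  by rewrite ler_pM2l// nrmD.
have g2n y : nrm (g2 y) <= 2^-1 * nrm y.
  rewrite nrmZ gtr0_norm// nrmi (le_trans _ (bound _ _ _ (hC y) (hC' y)))//.
  by rewrite ler_pM2l// nrmB.
have fE y : (t + t)%:C%C *: f y = g1 y - 'i%C *: g2 y.
  rewrite /g1 /g2 [in RHS]scalerA [_ * t%:C%C]mulrC -scalerA i_sq -scalerBr opprK.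
  by rewrite addrACA subrr addr0 rmorphD /= scalerDl scalerDr; reflexivity.
apply: funext => x /=.
have tt0 : (t + t)%:C%C != 0 :> R[i].
  by rewrite (_ : 0 = 0%:C%C)// (inj_eq (@complexI _)) gt_eqF// addr_gt0.
apply: (scalerI tt0).
rewrite -(linear_scale _ _ EAl) !fE (linear_sub _ _ EAl).
rewrite (comm_selfadjoint x mA g1M g1s g1n) (linear_scale 'i%C (g2 x) EAl).
by rewrite (comm_selfadjoint x mA g2M g2s g2n).
Qed.

End Commutation.

(** * The distribution of the operator under the trace *)

Section TraceMeasure.
Context {R : realType} {H : completeNormedModType R[i]}.
Variable dot : inner_product H.
Hypothesis dotE : induces_norm dot.
Variable T : @unbounded_operator R H.
Variable E : set (measurableTypeR R) -> H -> H.
Hypothesis ET : spectral_measure_of dot T E.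
Variable M : set (H -> H).
Hypothesis vnM : von_neumann_algebra dot M.
Variable tau : (H -> H) -> R[i].
Hypothesis trM : normal_faithful_trace dot M tau.
Hypothesis EM : forall A, measurable A -> M (E A).

Lemma vn_subalgebra : unital_subalgebra M.
Proof.
have [MB _ MM] := vnM; rewrite -MM; apply: commutant_subalgebra => q [].
by case.
Qed.

Lemma pvm_dot A x : measurable A -> dot (E A x) x = (nrm (E A x) ^+ 2)%:C%C.
Proof.
move=> mA; rewrite -(dotxx dotE) -{1}(pvm_idem ET x mA).
by have [[_ h] _] := pvmP ET mA; rewrite h.
Qed.

Lemma pvm_op_ge0 A : measurable A -> op_ge0 dot (E A).
Proof. by move=> mA x; rewrite pvm_dot// ler0c sqr_ge0. Qed.

Lemma pvm_op_le A B : measurable A -> measurable B -> A `<=` B ->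
  op_le dot (E A) (E B).
Proof.
move=> mA mB AB x; rewrite -[(_ - _) x]/(E B x - E A x).
have -> : dot (E B x - E A x) x = dot (E B x) x - dot (E A x) x.
  exact: linearBl.
rewrite !pvm_dot// -rmorphB /= ler0c subr_ge0.
have [mu [h _ _]] := spectral_distribution dotE ET x.
by rewrite -lee_fin -!h// le_measure// inE.
Qed.

Definition trE A : R := complex.Re (tau (E A)).

Lemma tau_pvm A : measurable A -> tau (E A) = (trE A)%:C%C.
Proof.
move=> mA; rewrite /trE RRe_real// ger0_real// (trace_ge0 trM) //; first exact: EM.
exact: pvm_op_ge0.
Qed.

Lemma trE_ge0 A : measurable A -> 0 <= trE A.
Proof.
move=> mA; rewrite -ler0c -tau_pvm// (trace_ge0 trM) //; first exact: EM.
exact: pvm_op_ge0.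
Qed.

(** Continuity from below is normality of the trace: E(U) is the least upper bound
    of the E(B_n) in M, because the scalar measures |E(.)x|^2 are continuous from
    below. *)
Lemma trE_cvg (B : nat -> set (measurableTypeR R)) :
  (forall n, measurable (B n)) -> nondecreasing_seq B ->
  trE (B n) @[n --> \oo] --> trE (\bigcup_n B n).
Proof.
move=> mB ndB; set U := \bigcup_n B n.
have mU : measurable U by exact: bigcupT_measurable.
have ndB' i j : (i <= j)%N -> B i `<=` B j by move=> ij; apply/subsetPset/ndB.
pose D := range (E \o B).
have DM : D `<=` M by move=> _ [n _ <-]; exact: EM.
have D0 : D `<=` op_ge0 dot by move=> _ [n _ <-]; exact: pvm_op_ge0.
have Dd : directed dot D.
  split; first by exists (E (B 0%N)), 0%N.
  move=> _ _ [n _ <-] [m _ <-]; exists (E (B (maxn n m))).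
  split; first by exists (maxn n m).
    by apply: pvm_op_le => //; apply: ndB'; exact: leq_maxl.
  by apply: pvm_op_le => //; apply: ndB'; exact: leq_maxr.
have Ds : op_sup dot M D (E U).
  split; first exact: EM.
    by move=> _ [n _ <-]; apply: pvm_op_le => //; exact: bigcup_sup.
  move=> t tM tub x.
  have sub A : measurable A ->
      dot ((t - E A) x) x = dot (t x) x - (nrm (E A x) ^+ 2)%:C%C.
    by move=> mA; rewrite -pvm_dot//; exact: linearBl.
  have tn n : ((nrm (E (B n) x) ^+ 2)%:C%C <= dot (t x) x)%R.
    by rewrite -subr_ge0 -sub//; apply: tub; exists n.
  have tr : dot (t x) x = (complex.Re (dot (t x) x))%:C%C.
    rewrite RRe_real// ger0_real// (le_trans _ (tn 0%N))//.
    by rewrite ler0c sqr_ge0.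
  rewrite sub// subr_ge0 tr lecR.
  have [mu [h _ _]] := spectral_distribution dotE ET x.
  rewrite -lee_fin -h//.
  have cv := nondecreasing_cvg_mu mB mU ndB (mu := mu).
  rewrite -(cvg_lim _ cv)//; apply: lime_le; first by apply/cvg_ex; eexists; exact: cv.
  by apply: nearW => n /=; rewrite h// lee_fin -lecR -tr.
have [ub lub] := trace_normal trM DM D0 Dd Ds.
have ub' n : trE (B n) <= trE U.
  rewrite -lecR -!tau_pvm//; apply: ub; exists (E (B n)) => //.
  by exists n.
have nd i j : (i <= j)%N -> trE (B i) <= trE (B j).
  move=> ij; rewrite -lecR -!tau_pvm// -subr_ge0.
  have Mi := EM (mB i); have Mj := EM (mB j).
  have e : tau (E (B j) - E (B i)) = tau (E (B j)) - tau (E (B i)).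
    by rewrite addrC -scaleN1r (trace_linear trM)// mulN1r addrC.
  rewrite -e (trace_ge0 trM)//.
    have [_ lin _] := vn_subalgebra.
    by rewrite addrC -scaleN1r; exact: lin.
  by apply: pvm_op_le => //; exact: ndB'.
apply/cvgrPdist_lt => e e0.
have [N hN] : exists N, trE U - e < trE (B N).
  apply: contrapT => /forallNP h.
  suff : tau (E U) <= (trE U - e)%:C%C.
    by rewrite tau_pvm// lecR lerBrDl gerDr leNgt e0.
  apply: lub => _ [_ [n _ <-] <-] /=.
  by rewrite tau_pvm// lecR leNgt; apply/negP; exact: h.
exists N => // n /= Nn.
rewrite ger0_norm ?subr_ge0//.
by have := nd _ _ Nn; have := hN; lra.
Qed.

Lemma pvmU A B x : measurable A -> measurable B -> A `&` B = set0 ->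
  E (A `|` B) x = E A x + E B x.
Proof.
move=> mA mB AB; rewrite -[LHS](pvm_setC dotE ET _ mA).
have mC := measurableC mA; have mU := measurableU _ _ mA mB.
rewrite -!(pvmI ET)// setIUr setIid setUidl; last by rewrite AB.
rewrite setIUr setICl set0U; congr (_ + E _ _).
by rewrite setIC; apply/setIidl => y By Ay; have : (A `&` B) y by []; rewrite AB.
Qed.

Lemma trEU A B : measurable A -> measurable B -> A `&` B = set0 ->
  trE (A `|` B) = trE A + trE B.
Proof.
move=> mA mB AB; rewrite /trE.
rewrite (_ : E (A `|` B) = 1 *: E A + E B).
  by rewrite (trace_linear trM) ?mul1r ?ReD//; exact: EM.
by apply: funext => x; rewrite scale1r pvmU.
Qed.

Lemma trE0 : trE set0 = 0.
Proof.
have /= := trEU measurable0 measurable0 (setI0 _); rewrite setU0 => /eqP.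
by rewrite -subr_eq0 opprD addrA subrr add0r oppr_eq0 => /eqP.
Qed.

Lemma trace_distribution : exists P : probability (measurableTypeR R) R,
  forall A, measurable A -> tau (E A) = (fine (P A))%:C%C.
Proof.
pose m (A : set (measurableTypeR R)) : \bar R :=
  if pselect (measurable A) then (trE A)%:E else 0%E.
have mE A : measurable A -> m A = (trE A)%:E by rewrite /m; case: pselect.
have m0 : m set0 = 0%E by rewrite mE// trE0.
have m_ge0 A : (0 <= m A)%E.
  by rewrite /m; case: pselect => // mA; rewrite lee_fin trE_ge0.
have m_sa : semi_sigma_additive m.
  move=> F mF tF mU; rewrite mE//.
  pose B n := \big[setU/set0]_(i < n) F i.
  have mB n : measurable (B n) by apply: bigsetU_measurable => i _; exact: mF.
  have UB : \bigcup_n F n = \bigcup_n B n.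
    apply/seteqP; split=> x [n _]; rewrite /B.
      by move=> Fx; exists n.+1 => //=; rewrite -bigcup_mkord; exists n => /=.
    by rewrite -bigcup_mkord => -[k _ Fk]; exists k.
  have sumE n : (\sum_(0 <= i < n) m (F i))%E = (trE (B n))%:E.
    elim: n => [|n ih]; first by rewrite big_geq// /B big_ord0 trE0.
    rewrite big_nat_recr//= ih mE// -EFinD /B big_ord_recr /= trEU//.
      exact: mB.
    rewrite -bigcup_mkord -subset0 => x [[k /= kn Fk] Fn].
    by have := tF k n I I (ex_intro _ x (conj Fk Fn)) => kE; rewrite kE ltnn in kn.
  rewrite UB; under eq_fun do rewrite sumE.
  apply: cvg_EFin; first by apply: nearW.
  apply: trE_cvg => // i j ij; apply/subsetPset; exact: subset_bigsetU.
pose mu : {measure set (measurableTypeR R) -> \bar R} :=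
  HB.pack m (isMeasure.Build _ _ _ m m0 m_ge0 m_sa).
have mu1 : mu setT = 1%E.
  rewrite -[mu setT]/(m setT) mE// /trE (_ : E setT = id) ?(trace_id trM)//.
  by apply: funext => x; exact: (pvmT ET).
pose P : probability (measurableTypeR R) R :=
  HB.pack (Measure.sort mu) (Measure_isProbability.Build _ _ _ mu mu1).
exists P => A mA.
by rewrite -[P A]/(m A) mE// tau_pvm.
Qed.

End TraceMeasure.

(** * Traces of words in two free algebras *)

Section Expansion.
Context {R : realType} {H : completeNormedModType R[i]}.
Context {d : measure_display} {X : measurableType d}.
Variables (M : set (H -> H)) (tau : (H -> H) -> R[i]).
Hypothesis M_alg : unital_subalgebra M.
Hypothesis tau_lin : forall (a : R[i]) f g, M f -> M g ->
  tau (a *: f + g) = a * tau f + tau g.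
Hypothesis tau1 : tau id = 1.
Hypothesis Mlin : forall f, M f -> linear f.
Variable E : set X -> H -> H.
Hypothesis EM : forall A, measurable A -> M (E A).
Hypothesis EI : forall A B, measurable A -> measurable B ->
  E (A `&` B) = E A \o E B.
Variable B : set (H -> H).
Hypothesis B_alg : unital_subalgebra B.
Hypothesis BM : B `<=` M.
Hypothesis EB_free : free_pair tau (generated_algebra (E @` measurable)) B.
Variable N : nat.

Implicit Types (A : 'I_N -> set X) (s : seq 'I_N) (ll : seq (seq 'I_N)).

Definition meet A s : set X := \big[setI/setT]_(i <- s) A i.

Definition block_product A ll : R[i] := \prod_(s <- ll) tau (E (meet A s)).

(** The coefficients do not depend on the sets A_i, and every block product uses
    each index listed in l exactly once; this is what makes f extend to a
    measure. *)
Definition block_combination (l : seq 'I_N) (f : ('I_N -> set X) -> R[i]) :=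
  exists cs : seq (R[i] * seq (seq 'I_N)),
    (forall c, c \in cs -> perm_eq (flatten c.2) l) /\
    forall A, (forall i, measurable (A i)) ->
      f A = \sum_(c <- cs) c.1 * block_product A c.2.

Lemma block_combination_ext l f g :
  (forall A, (forall i, measurable (A i)) -> f A = g A) ->
  block_combination l f -> block_combination l g.
Proof. by move=> fg [cs [h1 h2]]; exists cs; split=> // A mA; rewrite -fg// h2. Qed.

Lemma block_combination_perm l l' f : perm_eq l l' ->
  block_combination l f -> block_combination l' f.
Proof.
move=> ll' [cs [h1 h2]]; exists cs; split=> // c /h1 h.
exact: perm_trans h ll'.
Qed.

Lemma block_combination0 l : block_combination l (fun=> 0).
Proof. by exists [::]; split=> // A _; rewrite big_nil. Qed.

Lemma block_combination1 : block_combination [::] (fun=> 1).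
Proof.
exists [:: (1, [::])]; split=> [c|A _]; first by rewrite inE => /eqP ->.
by rewrite big_seq1 /block_product big_nil mulr1.
Qed.

Lemma block_combinationD l f g : block_combination l f -> block_combination l g ->
  block_combination l (fun A => f A + g A).
Proof.
move=> [cs [h1 h2]] [ds [k1 k2]]; exists (cs ++ ds); split.
  by move=> c; rewrite mem_cat => /orP[/h1|/k1].
by move=> A mA; rewrite big_cat /= h2// k2.
Qed.

Lemma block_combinationZ l f (a : R[i]) : block_combination l f ->
  block_combination l (fun A => a * f A).
Proof.
move=> [cs [h1 h2]]; exists [seq (a * c.1, c.2) | c <- cs]; split.
  by move=> _ /mapP[c /h1 h ->].
move=> A mA; rewrite h2// big_map mulr_sumr; apply: eq_bigr => c _.
by rewrite mulrA.
Qed.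

Lemma block_combinationM l f s : block_combination l f ->
  block_combination (s ++ l) (fun A => tau (E (meet A s)) * f A).
Proof.
move=> [cs [h1 h2]]; exists [seq (c.1, s :: c.2) | c <- cs]; split.
  by move=> _ /mapP[c /h1 h ->] /=; rewrite perm_cat2l.
move=> A mA; rewrite h2// big_map mulr_sumr; apply: eq_bigr => c _.
by rewrite /block_product big_cons mulrCA.
Qed.

(** A letter is a spectral projection, given by the indices of the sets to be
    intersected, or an element of B. Keeping the indices rather than the sets
    lets the same word be evaluated at every choice of the A_i. *)
Definition letter := (seq 'I_N + {b | B b})%type.

Definition is_spectral (x : letter) := if x is inl _ then true else false.

Definition indices (x : letter) := if x is inl s then s else [::].

Definition value A (x : letter) : H -> H :=
  match x with inl s => E (meet A s) | inr b => sval b end.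

Definition centered A (x : letter) : H -> H := value A x - tau (value A x) *: id.

Definition word_indices (w : seq letter) := flatten (map indices w).

Definition word_value A (w : seq letter) : H -> H :=
  \big[(fun f g : H -> H => f \o g)/id]_(x <- w) value A x.

Definition centered_value A (w : seq letter) : H -> H :=
  \big[(fun f g : H -> H => f \o g)/id]_(x <- w) centered A x.

Lemma measurable_meet A s : (forall i, measurable (A i)) -> measurable (meet A s).
Proof. by move=> mA; apply: bigsetI_measurable. Qed.

Lemma value_M A x : (forall i, measurable (A i)) -> M (value A x).
Proof.
move=> mA; case: x => [s|[b Bb]] /=; last exact: BM.
exact/EM/measurable_meet.
Qed.

Lemma subalgebra_center (D : set (H -> H)) f (c : R[i]) : unital_subalgebra D ->
  D f -> D (f - c *: id).
Proof.
by move=> [D1 Dl _] Df; rewrite addrC -scaleNr; exact: Dl.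
Qed.

Lemma centered_M A x : (forall i, measurable (A i)) -> M (centered A x).
Proof. by move=> mA; apply: subalgebra_center => //; exact: value_M. Qed.

Lemma word_M A w : (forall i, measurable (A i)) -> M (word_value A w).
Proof.
move=> mA; have [M1 _ MC] := M_alg; apply: big_ind => // x _; exact: value_M.
Qed.

Lemma centered_word_M A w : (forall i, measurable (A i)) -> M (centered_value A w).
Proof.
move=> mA; have [M1 _ MC] := M_alg; apply: big_ind => // x _; exact: centered_M.
Qed.

Lemma word_value_cons A x w : word_value A (x :: w) = value A x \o word_value A w.
Proof. by rewrite /word_value big_cons. Qed.

Lemma word_value_cat A w w' :
  word_value A (w ++ w') = word_value A w \o word_value A w'.
Proof.
elim: w => [|x w ih]; first by rewrite /word_value big_nil.
by rewrite cat_cons !word_value_cons ih.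
Qed.

Lemma centered_value_rcons A w x :
  centered_value A (rcons w x) = centered_value A w \o centered A x.
Proof.
elim: w => [|y w ih]; first by rewrite /centered_value /= big_cons !big_nil.
by rewrite rcons_cons /centered_value !big_cons -/(centered_value A _) ih.
Qed.

(** x = (x - tau x) + tau x, applied to the first letter that is not centered. *)
Lemma tau_split A w x w' : (forall i, measurable (A i)) ->
  tau (centered_value A w \o word_value A (x :: w')) =
  tau (centered_value A (rcons w x) \o word_value A w') +
  tau (value A x) * tau (centered_value A w \o word_value A w').
Proof.
move=> mA; have [_ _ MC] := M_alg.
have Mw := centered_word_M w mA; have Mw' := word_M w' mA.
rewrite addrC -tau_lin; last 2 first.
- exact: MC.
- by apply: (MC) => //; exact: centered_word_M.
congr tau; apply: funext => y.
rewrite word_value_cons centered_value_rcons.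
change (centered_value A w (value A x (word_value A w' y)) =
  tau (value A x) *: centered_value A w (word_value A w' y) +
  centered_value A w (value A x (word_value A w' y) -
                      tau (value A x) *: word_value A w' y)).
by rewrite (linear_sub _ _ (Mlin Mw)) (linear_scale _ _ (Mlin Mw)) addrC subrK.
Qed.

Lemma block_combination_tau l f x : block_combination l f ->
  block_combination (indices x ++ l) (fun A => tau (value A x) * f A).
Proof.
by case: x => [s|b] h /=; [exact: block_combinationM|exact: block_combinationZ].
Qed.

Definition expandable (w : seq letter) :=
  block_combination (word_indices w) (fun A => tau (word_value A w)).

Lemma word_indices_cat w w' :
  word_indices (w ++ w') = word_indices w ++ word_indices w'.
Proof. by rewrite /word_indices map_cat flatten_cat. Qed.

(** Undoing the centering of the letters of w only produces words that are no
    longer than the given one. *)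
Lemma mixed_expandable n : (forall w, (size w < n)%N -> expandable w) ->
  forall w w', (size w + size w' < n)%N ->
  block_combination (word_indices (w ++ w'))
    (fun A => tau (centered_value A w \o word_value A w')).
Proof.
move=> IH w; elim/last_ind: w => [|w x ih] w' wn.
  have := IH w' wn; apply: block_combination_ext => A _.
  by rewrite /centered_value big_nil.
rewrite size_rcons addSn in wn.
have h1 : block_combination (word_indices (w ++ x :: w'))
    (fun A => tau (centered_value A w \o word_value A (x :: w'))).
  by apply: ih; rewrite /= addnS.
have h2 : block_combination (word_indices (w ++ w'))
    (fun A => tau (centered_value A w \o word_value A w')).
  by apply: ih; exact: ltnW.
have h3 := block_combinationZ (-1) (block_combination_tau x h2).
rewrite cat_rcons.
have pe : perm_eq (indices x ++ word_indices (w ++ w')) (word_indices (w ++ x :: w')).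
  by rewrite !word_indices_cat perm_catCA.
have := block_combinationD h1 (block_combination_perm pe h3).
apply: block_combination_ext => A mA.
by rewrite tau_split// mulN1r addrK.
Qed.

Definition alternating (w : seq letter) :=
  sorted (fun x y => is_spectral x != is_spectral y) w.

Lemma tau_alternating_centered A w : (forall i, measurable (A i)) ->
  alternating w -> (0 < size w)%N -> tau (centered_value A w) = 0.
Proof.
case: w => // x0 w0 mA alt _; set w := x0 :: w0 in alt *.
rewrite /centered_value (big_nth x0) big_mkord.
have [M1 Ml _] := M_alg.
apply: (EB_free (k := fun i => is_spectral (nth x0 w i))).
- move=> i; rewrite /centered; case: (nth x0 w i) => [s|[b Bb]] /=.
    move=> D [[D1 Dl DC] DE]; apply: subalgebra_center => //.
    by apply: DE; exists (meet A s) => //; exact: measurable_meet.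
  exact: subalgebra_center.
- move=> i; rewrite /centered.
  have vM := value_M (nth x0 w i) mA.
  by rewrite addrC -scaleNr tau_lin// tau1 mulr1 addNr.
- move=> i j ji; apply/eqP.
  move: alt => /(sortedP x0) /(_ i); rewrite -ji; apply.
  exact: ltn_ord.
Qed.

(** The letters of w' are centered one after the other; each time the correction
    term has lost a letter, and what remains at the end is zero by freeness. *)
Lemma alternating_expandable n : (0 < n)%N ->
  (forall w, (size w < n)%N -> expandable w) ->
  forall w' w, (size w + size w')%N = n -> alternating (w ++ w') ->
  block_combination (word_indices (w ++ w'))
    (fun A => tau (centered_value A w \o word_value A w')).
Proof.
move=> n0 IH; elim=> [|x w' ih] w wn alt.
  move: wn alt; rewrite cats0 /= addn0 => wn alt.
  apply: block_combination_ext (block_combination0 _) => A mA.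
  rewrite /word_value big_nil -[X in tau X]/(centered_value A w).
  by rewrite tau_alternating_centered// wn.
have h1 : block_combination (word_indices (rcons w x ++ w'))
    (fun A => tau (centered_value A (rcons w x) \o word_value A w')).
  by apply: ih; rewrite ?size_rcons ?cat_rcons// addSn -wn /= addnS.
have h2 : block_combination (word_indices (w ++ w'))
    (fun A => tau (centered_value A w \o word_value A w')).
  by apply: (mixed_expandable IH); rewrite -wn /= addnS.
rewrite cat_rcons in h1.
have pe : perm_eq (indices x ++ word_indices (w ++ w')) (word_indices (w ++ x :: w')).
  by rewrite !word_indices_cat perm_catCA.
have := block_combinationD h1 (block_combination_perm pe (block_combination_tau x h2)).
by apply: block_combination_ext => A mA; rewrite tau_split.
Qed.

Lemma not_sorted_split (I : Type) (e : rel I) (w : seq I) : ~~ sorted e w ->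
  exists w1 x y w2, w = w1 ++ x :: y :: w2 /\ ~~ e x y.
Proof.
elim: w => [//|x [//|y w] ih] /=.
rewrite negb_and => /orP[exy|/ih [w1 [x' [y' [w2 [-> h]]]]]].
  by exists [::], x, y, w.
by exists (x :: w1), x', y', w2.
Qed.

Lemma merge_letters x y : is_spectral x = is_spectral y ->
  exists z, indices z = indices x ++ indices y /\
    forall A, (forall i, measurable (A i)) -> value A z = value A x \o value A y.
Proof.
case: x y => [s|[b Bb]] [t|[c Bc]] //= _.
  exists (inl (s ++ t)); split=> // A mA /=.
  by rewrite /meet big_cat /= EI//; exact: measurable_meet.
have [_ _ BC] := B_alg.
by exists (inr (exist _ (b \o c) (BC _ _ Bb Bc))).
Qed.

(** By induction on the length: two adjacent letters from the same algebra merge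
    into one, and if there are none the word is alternating. *)
Lemma word_expandable w : expandable w.
Proof.
have [n wn] := ubnP (size w); elim: n => // n IH in w wn *.
have {}IH w' : (size w' < size w)%N -> expandable w'.
  by move=> h; apply: IH; exact: leq_trans h _.
have [alt|/not_sorted_split [w1 [x [y [w2 [wE /negPn /eqP]]]]]] :=
    boolP (alternating w).
  case: w => [|x w] in alt IH wn *.
    apply: block_combination_ext block_combination1 => A _.
    by rewrite /word_value big_nil; exact: esym tau1.
  have := @alternating_expandable _ (ltn0Sn (size w)) IH (x :: w) [::] erefl alt.
  by apply: block_combination_ext => A _; rewrite /centered_value big_nil.
move=> /merge_letters [z [zi zv]].
have /IH : (size (w1 ++ z :: w2) < size w)%N by rewrite wE !size_cat /= !addnS.
rewrite /expandable wE.
have -> : word_indices (w1 ++ z :: w2) = word_indices (w1 ++ x :: y :: w2).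
  by rewrite !word_indices_cat /word_indices /= zi -!catA.
apply: block_combination_ext => A mA.
by rewrite !word_value_cat !word_value_cons zv.
Qed.

End Expansion.

(** * Block products are values of probability measures on boxes *)

Section BlockMeasures.
Context {R : realType} {d : measure_display} {X : measurableType d}.
Variables (P : probability X R) (x0 : X) (N : nat).
Implicit Types (A : 'I_N -> set X) (s : seq 'I_N) (ll : seq (seq 'I_N)).

Lemma meetP A s x : meet A s x <-> forall i, i \in s -> A i x.
Proof.
rewrite /meet; elim: s => [|j s ih]; first by rewrite big_nil.
rewrite big_cons; split=> [[Aj /ih h] i|h].
  by rewrite inE => /predU1P[->//|/h].
split; first by apply: h; rewrite mem_head.
by apply/ih => i si; apply: h; rewrite inE si orbT.
Qed.

Lemma eq_meet A A' s : (forall i, i \in s -> A i = A' i) -> meet A s = meet A' s.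
Proof.
by move=> h; rewrite /meet; apply: eq_big_seq => i /h.
Qed.

Lemma measurable_box A : (forall i, measurable (A i)) -> measurable (box A).
Proof.
move=> mA; rewrite (_ : box A =
    \bigcap_(i in [set: 'I_N]) ((@tnth N X) ^~ i @^-1` A i)).
  apply: fin_bigcap_measurable => // i _; rewrite -[X in measurable X]setTI.
  by apply: measurable_tnth.
by apply/seteqP; split=> x h i; [move=> _; exact: h|exact: h].
Qed.

Definition diagonal s (p : X * N.-tuple X) : N.-tuple X :=
  [tuple if i \in s then p.1 else tnth p.2 i | i < N].

Lemma measurable_diagonal s : measurable_fun setT (diagonal s).
Proof.
apply/measurable_fun_tnthP => i.
rewrite (_ : _ \o _ =
    fun p : X * N.-tuple X => if i \in s then p.1 else tnth p.2 i).
  case: (i \in s); first exact: measurable_fst.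
  apply: (@measurableT_comp _ _ _ _ _ _ (fun x : N.-tuple X => tnth x i)).
    exact: measurable_tnth.
  exact: measurable_snd.
by apply: funext => p /=; rewrite tnth_mktuple.
Qed.

(** Block by block: a new block s draws one point with law P and copies it to
    all the coordinates in s, independently of the other blocks. *)
Lemma block_measure ll : uniq (flatten ll) ->
  exists nu : probability (N.-tuple X) R, forall A,
    (forall i, measurable (A i)) -> (forall i, i \notin flatten ll -> A i = setT) ->
    nu (box A) = (\prod_(s <- ll) fine (P (meet A s)))%:E.
Proof.
elim: ll => [_|s ll ih].
  exists (dirac [tuple x0 | i < N]) => A mA AT; rewrite big_nil.
  rewrite (_ : box A = setT) ?probability_setT//.
  by apply/seteqP; split=> // x _ i; rewrite AT.
rewrite /= cat_uniq => /and3P[us /hasPn sll ull].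
have [nu nuE] := ih ull.
pose D : {mfun (X * N.-tuple X)%type >-> N.-tuple X} :=
  HB.pack (diagonal s) (isMeasurableFun.Build _ _ _ _ _ (measurable_diagonal s)).
exists (distribution (P \x nu)%E D) => A mA AT.
(* the condition on the coordinates in s is carried by the first factor *)
pose A' i := if i \in s then setT else A i.
have mA' i : measurable (A' i) by rewrite /A'; case: ifP.
rewrite /distribution /pushforward /=.
have -> : diagonal s @^-1` box A = meet A s `*` box A'.
  apply/seteqP; split=> -[x t] /=.
    move=> h; split=> /=.
      by apply/meetP => i si; have := h i; rewrite tnth_mktuple si.
    by move=> i; have := h i; rewrite tnth_mktuple /A'; case: ifP.
  move=> [/= /meetP h1 h2] i; rewrite tnth_mktuple /=.
  by have := h2 i; rewrite /A'; case: ifP => // /h1.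
have mm : measurable (meet A s) by exact: measurable_meet.
rewrite product_measure1E//; last exact: measurable_box.
rewrite big_cons EFinM fineK ?fin_num_measure//; congr (_ * _)%E.
apply: etrans (nuE A' mA' _) _.
  move=> i ill; rewrite /A'; case: ifPn => // si.
  by apply: AT; rewrite /= mem_cat negb_or si.
congr (_%:E); apply: eq_big_seq => t tll; congr (fine (P _)).
apply: eq_meet => i it.
rewrite /A'; case: ifPn => // si.
have /sll : i \in flatten ll by apply/flattenP; exists t.
by rewrite /= si.
Qed.

End BlockMeasures.

Section ComplexMeasures.
Context {R : realType} {d : measure_display} {T : measurableType d}.

Lemma cvg_real_complex (u : R^nat) (l : R) : u @ \oo --> l ->
  (fun n => (u n)%:C%C : (R[i] : numFieldType)) @ \oo -->
  (l%:C%C : (R[i] : numFieldType)).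
Proof.
move=> /cvgrPdist_lt ul; apply/cvgrPdist_lt => e e0.
have eE : e = (complex.Re e)%:C%C by rewrite RRe_real// gtr0_real.
move: e0; rewrite eE ltcR => /ul; apply: filterS => n.
by rewrite -rmorphB /= normc_def /= expr0n addr0 sqrtr_sqr ltcR.
Qed.

Lemma probability_countably_additive (P : probability T R) :
  countably_additive (fun S => (fine (P S))%:C%C : R[i]).
Proof.
move=> F mF tF; have mU : measurable (\bigcup_n F n) by exact: bigcupT_measurable.
have fP S : measurable S -> P S \is a fin_num by exact: fin_num_measure.
have cv : (fun n => \sum_(0 <= i < n) P (F i))%E @ \oo --> P (\bigcup_n F n).
  exact: measure_semi_sigma_additive.
have cv' : series (fun k => fine (P (F k))) @ \oo --> fine (P (\bigcup_n F n)).
  rewrite (_ : series _ = fine \o (fun n => \sum_(0 <= i < n) P (F i))%E).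
    by apply: fine_cvg; rewrite fineK ?fP.
  by apply: funext => n; rewrite /series /= sum_fine// => i _; exact: fP.
rewrite (_ : series _ = fun n => (series (fun k => fine (P (F k))) n)%:C%C).
  exact: cvg_real_complex.
by apply: funext => n; rewrite /series /= rmorph_sum.
Qed.

Lemma probability_bounded_variation (P : probability T R) n (F : 'I_n -> set T) :
  (forall i, measurable (F i)) -> trivIset setT F ->
  \sum_(i < n) `|(fine (P (F i)))%:C%C : R[i]| <= 1.
Proof.
move=> mF tF; have mU : measurable (\big[setU/set0]_(i < n) F i).
  by apply: bigsetU_measurable.
have -> : \sum_(i < n) `|(fine (P (F i)))%:C%C : R[i]| =
    (fine (P (\big[setU/set0]_(i < n) F i)))%:C%C.
  rewrite measure_bigsetU_ord// -sum_fine; last by move=> i _; exact: fin_num_measure.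
  rewrite rmorph_sum; apply: eq_bigr => i _; rewrite ger0_norm// ler0c.
  by rewrite fine_ge0.
rewrite (_ : 1 = 1%:C%C)// lecR -lee_fin fineK ?fin_num_measure//.
exact: probability_le1.
Qed.

Lemma combination_complex_measure (I : Type) (cs : seq (R[i] * I))
    (P : I -> probability T R) :
  let nu (S : set T) : R[i] := \sum_(c <- cs) c.1 * (fine (P c.2 S))%:C%C in
  countably_additive nu /\ Defs.bounded_variation nu.
Proof.
move=> nu; split.
  move=> F mF tF; rewrite /nu {nu}.
  elim: cs => [|c cs ih].
    rewrite big_nil (_ : series _ = fun=> 0); first exact: cvg_cst.
    by apply: funext => n; rewrite /series /= big1// => i _; rewrite big_nil.
  rewrite (_ : series _ =
     (fun n => c.1 * series (fun k => (fine (P c.2 (F k)))%:C%C) n +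
     series ((fun S => \sum_(c <- cs) c.1 * (fine (P c.2 S))%:C%C) \o F) n)).
    rewrite big_cons; apply: cvgD; last exact: ih.
    apply: cvgM; first exact: cvg_cst.
    exact: probability_countably_additive mF tF.
  apply: funext => n; rewrite /series /= mulr_sumr -big_split /=.
  by apply: eq_bigr => i _; rewrite big_cons.
exists (\sum_(c <- cs) `|c.1|) => n F mF tF.
apply: (@le_trans _ _ (\sum_(i < n) \sum_(c <- cs)
    `|c.1| * `|(fine (P c.2 (F i)))%:C%C : R[i]|)).
  apply: ler_sum => i _; rewrite (le_trans (ler_norm_sum _ _ _))//.
  by apply: ler_sum => c _; rewrite normrM.
rewrite exchange_big /=; apply: ler_sum => c _.
rewrite -mulr_sumr ler_piMr//.
exact: probability_bounded_variation.
Qed.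

End ComplexMeasures.

(** * The theorem *)

Section Extension.
Context {R : realType} {H : completeNormedModType R[i]}.

Lemma generated_subalgebra (S : set (H -> H)) : unital_subalgebra (generated_algebra S).
Proof.
split=> [A [[] //]|a f g Sf Sg A AS|f g Sf Sg A AS].
- by have [[_ AL _] _] := AS; apply: AL; [exact: Sf|exact: Sg].
- by have [[_ _ Am] _] := AS; apply: Am; [exact: Sf|exact: Sg].
Qed.

Variables (tau : (H -> H) -> R[i]) (E : set (measurableTypeR R) -> H -> H).
Variable P : probability (measurableTypeR R) R.
Hypothesis tauP : forall A, measurable A -> tau (E A) = (fine (P A))%:C%C.

Lemma block_combination_extends N (m : ('I_N -> set (measurableTypeR R)) -> R[i]) :
  block_combination tau E (index_enum 'I_N) m -> extends_to_measure m.
Proof.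
move=> [cs [csN csE]].
pose x0 : measurableTypeR R := (0 : R).
have /choice[nu nuE] : forall ll : seq (seq 'I_N),
    exists nu : probability (N.-tuple (measurableTypeR R)) R,
      perm_eq (flatten ll) (index_enum 'I_N) ->
      forall A, (forall i, measurable (A i)) ->
        nu (box A) = (\prod_(s <- ll) fine (P (meet A s)))%:E.
  move=> ll; have [pll|npll] := boolP (perm_eq (flatten ll) (index_enum 'I_N)).
    have ull : uniq (flatten ll) by rewrite (perm_uniq pll) index_enum_uniq.
    have [nu nuE] := block_measure P x0 ull.
    exists nu => _ A mA; apply: nuE => // i.
    by rewrite (perm_mem pll) mem_index_enum.
  by exists (dirac [tuple x0 | i < N]).
have [ca bv] := combination_complex_measure cs nu.
eexists; split; [exact: ca|exact: bv|move=> A mA].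
rewrite csE//; apply: eq_big_seq => c ccs.
rewrite (nuE _ (csN _ ccs))// /block_product /= rmorph_prod; congr (_ * _).
by apply: eq_bigr => s _; rewrite tauP//; exact: measurable_meet.
Qed.

End Extension.

Section SpectralWords.
Context {R : realType} {H : completeNormedModType R[i]}.
Context {d : measure_display} {X : measurableType d}.
Variables (E : set X -> H -> H) (B : set (H -> H)) (N p : nat).
Variables (V : {b | B b}) (g : 'I_p -> 'I_N).

(** The word E(A_(g i)) V ... for i in l. With g the identity it gives m_, and
    with g the inclusion, followed by one more projection, it gives m1_. *)
Definition spectral_word (l : seq 'I_p) : seq (letter B N) :=
  flatten [seq [:: inl [:: g i]; inr V] | i <- l].

Lemma spectral_word_value A l : word_value E A (spectral_word l) =
  \big[(fun f g : H -> H => f \o g)/id]_(i <- l) (E (A (g i)) \o sval V).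
Proof.
elim: l => [|i l ih]; first by rewrite /word_value !big_nil.
by rewrite /spectral_word /= !word_value_cons ih big_cons /= /meet big_seq1.
Qed.

Lemma spectral_word_indices l : word_indices (spectral_word l) = map g l.
Proof. by elim: l => //= i l; rewrite /spectral_word /word_indices /= => ->. Qed.

End SpectralWords.

Theorem theorem4p5 (R : realType) (H : completeNormedModType R[i])
    (dot : inner_product H) (dotE : induces_norm dot)
    (M : set (H -> H)) (vnM : von_neumann_algebra dot M)
    (tau : (H -> H) -> R[i]) (trM : normal_faithful_trace dot M tau)
    (H0 : unbounded_operator) (H0sa : self_adjoint_unbounded dot H0)
    (H0M : affiliated dot M H0)
    (E : set (measurableTypeR R) -> H -> H)
    (EH0 : spectral_measure_of dot H0 E)
    (V : H -> H) (Vsa : self_adjoint dot V) (VM : M V)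
    (H0V : free_pair tau (generated_algebra (E @` measurable))
                         (generated_algebra [set V])) :
  forall p : nat, (0 < p)%N ->
    extends_to_measure (m_ (p := p) tau E V) /\
    extends_to_measure (m1_ (p := p) tau E V).
Proof.
move=> p _.
have M_alg := vn_subalgebra vnM.
have EM A : measurable A -> M (E A) := pvm_mem dotE H0sa EH0 vnM H0M (A := A).
have [P tauP] := trace_distribution dotE EH0 vnM trM EM.
have Mlin f : M f -> linear f by have [MB _ _] := vnM; case/MB.
have EI A B : measurable A -> measurable B -> E (A `&` B) = E A \o E B.
  by have [[_ _ h _] _] := EH0; exact: h.
pose B := generated_algebra [set V].
have B_alg : unital_subalgebra B := generated_subalgebra _.
have BM : B `<=` M by move=> f; apply; split=> // _ ->.
have BV : B V by move=> D [_]; apply.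
have expand N := @word_expandable R H _ _ M tau M_alg (trace_linear trM)
  (trace_id trM) Mlin E EM EI B B_alg BM H0V N.
pose v : {b | B b} := exist _ V BV.
split; apply: (block_combination_extends tauP).
- have := expand _ (spectral_word v id (index_enum 'I_p)).
  rewrite /expandable spectral_word_indices map_id.
  by apply: block_combination_ext => A mA; rewrite spectral_word_value.
- pose w := spectral_word v (widen_ord (leqnSn p)) (index_enum 'I_p) ++
            [:: inl [:: ord_max]].
  have wE : perm_eq (word_indices w) (index_enum 'I_p.+1).
    rewrite word_indices_cat spectral_word_indices /word_indices /=.
    apply: uniq_perm; rewrite ?index_enum_uniq//.
      rewrite cat_uniq /= orbF andbT map_inj_uniq ?index_enum_uniq /=; last first.
        by move=> i j /(congr1 val) /= ij; exact: val_inj.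
      apply/mapP => -[i _ /(congr1 val) /= ip].
      by have := ltn_ord i; rewrite -ip ltnn.
    move=> i; rewrite mem_index_enum mem_cat inE.
    have [ip|ip] := ltnP i p; last first.
      rewrite (_ : i == ord_max) ?orbT//; apply/eqP/val_inj/eqP.
      by rewrite eqn_leq ip -ltnS ltn_ord.
    apply/orP; left; apply/mapP; exists (Ordinal ip); first exact: mem_index_enum.
    exact: val_inj.
  apply: block_combination_perm wE _.
  have := expand _ w; apply: block_combination_ext => A mA.
  rewrite word_value_cat spectral_word_value word_value_cons /m1_ /=.
  by rewrite /meet big_seq1 /word_value big_nil.
Qed.
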